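(* Let $n\ge1$, $\kappa\in[-\tfrac1n,0)\cup(0,+\infty)$, and let $W$, $\Omega$, $\rho_{\kappa,W}$ be as in the context. Assume in addition that $W$ is of class $C^2$ on $\Omega$ and that $D^2W(x)$ is invertible for every $x\in\Omega$ (negative definite if $\kappa>0$, positive definite if $\kappa<0$). Then for every $C^1$ function $g$ compactly supported in $\Omega$ with $\int g\,\rho_{\kappa,W}=0$, setting $f=gW$, $$-\kappa\int\big(D^2W\big)^{-1}\nabla f\cdot\nabla f\,\rho_{\kappa,W}\ \ge\ \int g^2\,W\,\rho_{\kappa,W}.$$ Equivalently: - in Case 1 ($\beta=1/\kappa>0$): $\int(-D^2W)^{-1}\nabla f\cdot\nabla f\,\rho_{\beta,W}\ge\beta\int g^2W\rho_{\beta,W}$; - in Case 2 ($\beta=-1/\kappa\ge n$): $\int(D^2W)^{-1}\nabla f\cdot\nabla f\,\rho_{\beta,W}\ge\beta\int g^2W\rho_{\beta,W}$.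
   Context: Standing setting. Fix $n\ge1$ and $\kappa\in[-\tfrac1n,0)\cup(0,+\infty)$. Let $W:\mathbb{R}^n\to[0,+\infty)$ satisfy: - if $\kappa>0$: $\Omega:=\{W>0\}$ is a bounded open convex set, $W$ is concave on $\Omega$, and $W=0$ outside $\Omega$; - if $\kappa<0$: $W$ is convex on $\mathbb{R}^n$, and $\Omega:=\mathbb{R}^n$. Assume $\int_\Omega W^{1/\kappa}=1$, and set $\rho_{\kappa,W}=W^{1/\kappa}$ on $\Omega$ (and $0$ outside). *)

(* Defs.v *)
From HB Require Import structures.
From mathcomp Require Import all_boot all_order all_algebra.
From mathcomp Require Import all_classical all_reals all_analysis.
Set Implicit Arguments. Unset Strict Implicit. Unset Printing Implicit Defensive.
Import Order.TTheory GRing.Theory Num.Theory.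
Import numFieldNormedType.Exports.
Local Open Scope classical_set_scope.
Local Open Scope ring_scope.

Section Defs.
Variable R : realType.

Definition partial n (f : 'rV[R]_n -> R) (i : 'I_n) (x : 'rV[R]_n) : R :=
  'D_(delta_mx 0 i) f x.

Definition grad n (f : 'rV[R]_n -> R) (x : 'rV[R]_n) : 'rV[R]_n :=
  \row_i partial f i x.
Definition hessian n (f : 'rV[R]_n -> R) (x : 'rV[R]_n) : 'M[R]_n :=
  \matrix_(i, j) partial (partial f j) i x.

Definition C1_on n (U : set 'rV[R]_n) (f : 'rV[R]_n -> R) : Prop :=
  forall x, U x -> differentiable f x /\
    (forall i, {for x, continuous (partial f i)}).

Definition C2_on n (U : set 'rV[R]_n) (f : 'rV[R]_n -> R) : Prop :=
  C1_on U f /\ forall i, C1_on U (partial f i).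

Definition convex_set_rV n (A : set 'rV[R]_n) : Prop :=
  forall x y (t : R), A x -> A y -> 0 <= t <= 1 -> A ((1 - t) *: x + t *: y).

Definition concave_on n (A : set 'rV[R]_n) (f : 'rV[R]_n -> R) : Prop :=
  forall x y (t : R), A x -> A y -> 0 <= t <= 1 ->
    (1 - t) * f x + t * f y <= f ((1 - t) *: x + t *: y).

Definition convex_on n (A : set 'rV[R]_n) (f : 'rV[R]_n -> R) : Prop :=
  forall x y (t : R), A x -> A y -> 0 <= t <= 1 ->
    f ((1 - t) *: x + t *: y) <= (1 - t) * f x + t * f y.

Definition compactly_supported_in n (U : set 'rV[R]_n) (g : 'rV[R]_n -> R) : Prop :=
  exists K : set 'rV[R]_n, [/\ compact K, K `<=` U & forall x, ~ K x -> g x = 0].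

(* Lebesgue integral over R^n, realised as the iterated one-dimensional
   Lebesgue integral (first coordinate outermost). *)
Fixpoint iint (n : nat) : ('rV[R]_n -> \bar R) -> \bar R :=
  match n with
  | 0 => fun F => F 0
  | k.+1 => fun F =>
      (\int[@lebesgue_measure R]_t
         iint (fun v : 'rV[R]_k => F (row_mx (const_mx t : 'rV[R]_1) v)))%E
  end.

Definition rho n (kappa : R) (W : 'rV[R]_n -> R) (Omega : set 'rV[R]_n) :
    'rV[R]_n -> R :=
  fun x => if `[< Omega x >] then W x `^ kappa^-1 else 0.

End Defs.

(* Main.v *)
(* Write the measure as r(U) with U concave (U = W extended, or U = -W), and let
   phi be an antiderivative of r.  Solving div (r(U) v) = - h r(U) with a triangular
   (Knothe) field v on a large box, bounding the quadratic form of - D^2 U from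
   below by duality at v, and integrating by parts gives the inequality; the
   coordinates of v are found one at a time, so the whole argument is an induction
   on the dimension in which only one-dimensional calculus occurs.

   When kappa < 0 the box may be taken in R^n directly, W being positive because
   W^(1/kappa) would not be integrable near a zero of W.  When kappa > 0 the box
   leaves Omega, so W is first modified away from the support of g into a concave
   C^2 function on R^n, and s^(1/kappa) is continued by an exponential for small
   and negative s. *)
Require Import Defs.
From HB Require Import structures.
From mathcomp Require Import all_boot all_order all_algebra.
From mathcomp Require Import all_classical all_reals all_analysis.
From mathcomp Require Import ring lra.
Set Implicit Arguments. Unset Strict Implicit. Unset Printing Implicit Defensive.
Import Order.TTheory GRing.Theory Num.Theory.
Import numFieldNormedType.Exports.
Local Open Scope classical_set_scope.
Local Open Scope ring_scope.

(** The dimension enters only through the sequence [a]. On the slice at [t] the accumulated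
    divergence [m] becomes [m + s], and integrating by parts against [phi] costs [2 * m * s * phi].
    What survives the worst [s] is the minimum of [a_n (m + s)^2 - 2 m s], equal to
    [(2 - 1 / a_n) m^2] when [a_n > 0]. Hence the recursion [a_(n+1) = 2 - 1 / a_n], with [a_0]
    restricted by [a_0 phi <= r^2 / r']. For kappa < 0 and b = -1/kappa this gives
    [a_k = (b - k - 1) / (b - k)]. The induction starts in dimension n with m = 0, so signs matter
    only for [a_k] with k < n, and [a_(n-1) >= 0] says exactly b >= n, that is, kappa >= -1/n. For
    kappa > 0 the fixed point 1 of the recursion serves every dimension, and the restriction on
    [a_0] becomes the log-concavity of [phi]. This is what the continuation of s^(1/kappa) has to
    preserve. Taking m = 0 and h = f r'(U) / r(U) turns the general inequality into: the integral of
    f^2 r'(U) is at most that of e r(U). On the support of g, r'(U) is W^(1/kappa - 1) / |kappa|, so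
    h has mean zero because g rho does. *)

Section Continuity.
Context {R : realType} {T : topologicalType}.
Implicit Types f g : T -> R.

Lemma cont_comp (U V : topologicalType) (f : T -> U) (g : U -> V) :
  continuous f -> continuous g -> continuous (fun x => g (f x)).
Proof. by move=> cf cg x; apply: (@cvg_comp _ _ _ f g _ _ _ (cf x)); exact: cg. Qed.

Lemma contD f g : continuous f -> continuous g -> continuous (fun x => f x + g x).
Proof. by move=> cf cg x; apply: cvgD; [exact: cf|exact: cg]. Qed.

Lemma contN f : continuous f -> continuous (fun x => - f x).
Proof. by move=> cf x; apply: cvgN; exact: cf. Qed.

Lemma contB f g : continuous f -> continuous g -> continuous (fun x => f x - g x).
Proof. by move=> cf cg x; apply: cvgB; [exact: cf|exact: cg]. Qed.

Lemma contM f g : continuous f -> continuous g -> continuous (fun x => f x * g x).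
Proof. by move=> cf cg x; apply: cvgM; [exact: cf|exact: cg]. Qed.

Lemma contX f n : continuous f -> continuous (fun x => f x ^+ n).
Proof.
move=> cf; elim: n => [|n IH].
  by under eq_fun do rewrite expr0; exact: cst_continuous.
by under eq_fun do rewrite exprS; exact: contM.
Qed.

Lemma contC (c : R) : continuous (fun _ : T => c).
Proof. exact: cst_continuous. Qed.

Lemma cont_sum (I : Type) (r : seq I) (F : I -> T -> R) :
  (forall i, continuous (F i)) -> continuous (fun x => \sum_(i <- r) F i x).
Proof.
move=> cF; elim: r => [|i r IH].
  by under eq_fun do rewrite big_nil; exact: contC.
by under eq_fun do rewrite big_cons; exact: contD.
Qed.

End Continuity.

(** * Iterated integrals of continuous functions over a box *)

Section BoxIntegral.
Variable R : realType.
Implicit Types (L t s : R).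

Definition consV k t (v : 'rV[R]_k) : 'rV[R]_k.+1 :=
  row_mx (const_mx t : 'rV_1) v.

Lemma consV_head k t (v : 'rV[R]_k) : consV t v 0 0 = t.
Proof.
rewrite /consV mxE; case: splitP => j; first by rewrite mxE.
by rewrite /= addnE.
Qed.

Lemma consV_lift k t (v : 'rV[R]_k) j : consV t v 0 (lift 0 j) = v 0 j.
Proof.
rewrite /consV mxE; case: splitP => l; first by rewrite ord1.
by rewrite /= /bump /= add1n => -[/val_inj ->].
Qed.

Lemma rowP_cons k (x y : 'rV[R]_k.+1) :
  x 0 0 = y 0 0 -> (forall j, x 0 (lift 0 j) = y 0 (lift 0 j)) -> x = y.
Proof.
move=> h0 hS; apply/rowP => i.
by case: (unliftP 0 i) => [j ->|->]; [exact: hS|exact: h0].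
Qed.

Lemma consV_addl k s t (v : 'rV[R]_k) :
  consV (s + t) v = s *: delta_mx 0 0 + consV t v.
Proof.
apply: rowP_cons => [|j].
  by rewrite consV_head [RHS]mxE consV_head !mxE/= mulr1.
by rewrite consV_lift [RHS]mxE consV_lift !mxE/= mulr0 add0r.
Qed.

Lemma consV_addr k t (u v : 'rV[R]_k) :
  consV t (u + v) = consV 0 u + consV t v.
Proof.
apply: rowP_cons => [|j]; first by rewrite [RHS]mxE !consV_head add0r.
by rewrite [RHS]mxE !consV_lift mxE.
Qed.

Lemma consV_delta k s (i : 'I_k) :
  consV 0 (s *: delta_mx 0 i) = s *: delta_mx 0 (lift 0 i).
Proof.
apply: rowP_cons => [|j]; first by rewrite consV_head !mxE/= mulr0.
by rewrite consV_lift !mxE eqxx/= (inj_eq lift_inj).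
Qed.

Lemma continuous_consV k (T : topologicalType) (f : T -> R)
    (g : T -> 'rV[R]_k) : continuous f -> continuous g ->
  continuous (fun x => consV (f x) (g x)).
Proof.
move=> cf cg x A [P PM PA].
have h : \forall y \near x, forall i, P 0 i (consV (f y) (g y) 0 i).
  have h0 : \forall y \near x, P 0 0 (f y).
    by apply: (cf x (P 0 0)); have := PM 0 0; rewrite consV_head.
  have hS : \forall y \near x, forall j, P 0 (lift 0 j) (g y 0 j).
    apply: (cg x [set w | forall j, P 0 (lift 0 j) (w 0 j)]); exists (fun i j => P i (lift 0 j)).
      by move=> i j; rewrite ord1; have := PM 0 (lift 0 j); rewrite consV_lift.
    by move=> M /= MP j; exact: MP.
  apply: filterS2 h0 hS => y y0 yS i; case: (unliftP 0 i) => [j ->|->].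
    by rewrite consV_lift; exact: yS.
  by rewrite consV_head.
by apply: filterS h => y hy; apply: PA => i j; rewrite ord1; exact: hy.
Qed.

Definition box L k : set 'rV[R]_k := [set v | forall i, `|v 0 i| <= L].

Lemma box_compact L k : compact (box L (k := k)).
Proof.
rewrite (_ : box L (k := k) = [set v : 'rV[R]_k | forall i, `[- L, L]%classic (v ord0 i)]).
  by apply: (@rV_compact _ _ (fun=> `[- L, L]%classic)) => _; exact: segment_compact.
by apply/seteqP; split => v h i; have := h i; rewrite /= in_itv/= ler_norml.
Qed.

Lemma box_consV L k t (v : 'rV[R]_k) : `|t| <= L -> box L v -> box L (consV t v).
Proof.
move=> tL vL i; case: (unliftP 0 i) => [j ->|->]; first by rewrite consV_lift.
by rewrite consV_head.
Qed.

(** The tube lemma for the compact box: local uniformity becomes uniformity over a whole fibre, and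
    so does the work of dominated convergence below. *)
Lemma near_box L k (I : Type) (F : set_system I) (P : I -> 'rV[R]_k -> Prop) :
  Filter F ->
  (forall v, box L v -> \forall v' \near v & i \near F, P i v') ->
  \forall i \near F, forall v, box L v -> P i v.
Proof.
move=> FF; have := @box_compact L k.
by move/compact_near_coveringP => + h => /(_ _ _ _ FF h).
Qed.

(** Real-valued counterpart of [iint], peeling off coordinates in the same order, so that
    [iint_ibox] can identify the two one coordinate at a time. *)
Fixpoint ibox L n : ('rV[R]_n -> R) -> R :=
  match n with
  | 0 => fun F => F 0
  | k.+1 => fun F =>
      \int[@lebesgue_measure R]_(t in `[- L, L])
         ibox L (fun v : 'rV[R]_k => F (consV t v))
  end.

Lemma continuous_integrable_cc (f : R -> R) a b : continuous f ->
  (@lebesgue_measure R).-integrable `[a, b] (EFin \o f).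
Proof.
move=> cf; apply: continuous_compact_integrable; first exact: segment_compact.
exact: continuous_subspaceT.
Qed.

Lemma Rintegral_cst_cc a b c : a <= b ->
  \int[@lebesgue_measure R]_(t in `[a, b]) c = c * (b - a).
Proof.
move=> ab; rewrite Rintegral_cst//= lebesgue_measure_itv/=; congr (_ * _).
rewrite lte_fin; case: ltP => //= ba.
have -> : a = b by apply/eqP; rewrite eq_le ab ba.
by rewrite subrr.
Qed.

Lemma ibox_cst L n c : 0 <= L -> ibox L (fun _ : 'rV[R]_n => c) = c * (L *+ 2) ^+ n.
Proof.
move=> L0; elim: n => [|n IH] /=; first by rewrite mulr1.
under eq_Rintegral do rewrite IH.
rewrite Rintegral_cst_cc; last by rewrite (le_trans _ L0)// oppr_le0.
by rewrite opprK -mulr2n exprSr mulrA.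
Qed.

(** The two properties must be proved together: in dimension n + 1 both need integrable fibre
    integrals, hence their continuity, and that comes from [ibox_dist], which uses both properties
    in dimension n. *)
Let lin_mono L n :=
  (forall a (F G : 'rV[R]_n -> R), continuous F -> continuous G ->
    ibox L (fun x => F x + a * G x) = ibox L F + a * ibox L G) /\
  (forall F G : 'rV[R]_n -> R, continuous F -> continuous G ->
    (forall x, box L x -> F x <= G x) -> ibox L F <= ibox L G).

Lemma continuous_fiber k (F : 'rV[R]_k.+1 -> R) t : continuous F ->
  continuous (fun v => F (consV t v)).
Proof.
move=> cF; apply: cont_comp => //; apply: continuous_consV; first exact: contC.
by move=> v; exact: cvg_id.
Qed.

Let ibox_dist L n (F G : 'rV[R]_n -> R) (e : R) : 0 <= L -> lin_mono L n ->
  continuous F -> continuous G -> (forall x, box L x -> `|F x - G x| <= e) ->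
  `|ibox L F - ibox L G| <= e * (L *+ 2) ^+ n.
Proof.
move=> L0 [lin mono] cF cG FG.
have -> : ibox L F - ibox L G = ibox L (fun x => F x + (-1) * G x).
  by rewrite lin// mulN1r.
have cFG := contD cF (contM (contC (c := -1)) cG).
have cst (c : R) : continuous (fun _ : 'rV[R]_n => c) by exact: contC.
rewrite ler_norml -mulNr -!ibox_cst//; apply/andP; split; apply: mono => //.
- by move=> x /FG; rewrite ler_norml mulN1r => /andP[].
- by move=> x /FG; rewrite ler_norml mulN1r => /andP[].
Qed.

Let ibox_cont L n (F : 'rV[R]_n.+1 -> R) : 0 <= L -> lin_mono L n ->
  continuous F -> continuous (fun t => ibox L (fun v => F (consV t v))).
Proof.
move=> L0 lm cF t0; apply/cvgrPdist_le => e e0.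
(* The factor (2L)^n is the volume of the fibre box; adding 1 covers L = 0. *)
pose d := e / ((L *+ 2) ^+ n + 1).
have p0 : 0 <= (L *+ 2) ^+ n by rewrite exprn_ge0// mulrn_wge0.
have d0 : 0 < d by rewrite divr_gt0// ltr_wpDl.
have : \forall t \near t0, forall v : 'rV[R]_n, box L v ->
    `|F (consV t0 v) - F (consV t v)| <= d.
  apply: (@near_box L n R (nbhs t0) (fun t v => `|F (consV t0 v) - F (consV t v)| <= d)).
  move=> v _.
  have c1 : continuous (fun p : 'rV[R]_n * R =>
      F (consV t0 p.1) - F (consV p.2 p.1)).
    apply: contB; apply: cont_comp => //; apply: continuous_consV.
    - exact: contC.
    - by move=> p; exact: cvg_fst.
    - by move=> p; exact: cvg_snd.
    - by move=> p; exact: cvg_fst.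
  have /cvgrPdist_le := c1 (v, t0) => /(_ _ d0); apply: filterS => -[v' t] /=.
  by rewrite subrr sub0r normrN.
apply: filterS => t ht.
apply: (le_trans (ibox_dist L0 lm (continuous_fiber cF) (continuous_fiber cF) ht)).
rewrite /d mulrAC ler_pdivrMr ?ltr_wpDl// ler_wpM2l ?(ltW e0)//.
by rewrite lerDl.
Qed.

Let lin_monoP L n : 0 <= L -> lin_mono L n.
Proof.
move=> L0; elim: n => [|n IH].
  split => [//|F G _ _ h /=]; apply: h => -[//].
have [lin mono] := IH.
have int F : continuous F -> (@lebesgue_measure R).-integrable `[- L, L]
    (EFin \o (fun t => ibox L (fun v : 'rV[R]_n => F (consV t v)))).
  by move=> cF; apply: continuous_integrable_cc; exact: ibox_cont.
split => [a F G cF cG|F G cF cG FG] /=.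
  under eq_Rintegral do rewrite (lin _ _ _ (continuous_fiber cF) (continuous_fiber cG)).
  rewrite RintegralD//; last 2 first.
  - exact: int.
  - by apply: continuous_integrable_cc; apply: contM; [exact: contC|exact: ibox_cont].
  by rewrite RintegralZl//; exact: int.
apply: le_Rintegral => //; [exact: int|exact: int|move=> t /= tL].
apply: mono; [exact: continuous_fiber|exact: continuous_fiber|move=> v vL].
by apply/FG/box_consV => //; move: tL; rewrite in_itv/= ler_norml.
Qed.

Section facts.
Variables (L : R) (L0 : 0 <= L).

Lemma ibox_addM n a (F G : 'rV[R]_n -> R) : continuous F -> continuous G ->
  ibox L (fun x => F x + a * G x) = ibox L F + a * ibox L G.
Proof. by have [+ _] := @lin_monoP L n L0; apply. Qed.

Lemma le_ibox n (F G : 'rV[R]_n -> R) : continuous F -> continuous G ->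
  (forall x, box L x -> F x <= G x) -> ibox L F <= ibox L G.
Proof. by have [_] := @lin_monoP L n L0; apply. Qed.

Lemma ibox_distance n (F G : 'rV[R]_n -> R) (e : R) :
  continuous F -> continuous G -> (forall x, box L x -> `|F x - G x| <= e) ->
  `|ibox L F - ibox L G| <= e * (L *+ 2) ^+ n.
Proof. by apply: ibox_dist => //; exact: lin_monoP. Qed.

Lemma continuous_ibox n (F : 'rV[R]_n.+1 -> R) : continuous F ->
  continuous (fun t => ibox L (fun v => F (consV t v))).
Proof. by apply: ibox_cont => //; exact: lin_monoP. Qed.

Lemma eq_ibox n (F G : 'rV[R]_n -> R) : F =1 G -> ibox L F = ibox L G.
Proof. by move/funext => ->. Qed.

Lemma iboxZ n a (F : 'rV[R]_n -> R) : continuous F ->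
  ibox L (fun x => a * F x) = a * ibox L F.
Proof.
move=> cF; rewrite -[RHS]add0r -[in RHS](mul0r ((L *+ 2) ^+ n)) -ibox_cst//.
rewrite -ibox_addM//; last by exact: contC.
by apply: eq_ibox => x; rewrite add0r.
Qed.

Lemma iboxB n (F G : 'rV[R]_n -> R) : continuous F -> continuous G ->
  ibox L (fun x => F x - G x) = ibox L F - ibox L G.
Proof.
move=> cF cG; rewrite -mulN1r -ibox_addM//.
by apply: eq_ibox => x; rewrite mulN1r.
Qed.

End facts.

Lemma ibox_gt0 L n (F : 'rV[R]_n -> R) : 0 < L -> continuous F ->
  (forall x, 0 < F x) -> 0 < ibox L F.
Proof.
move=> L0 cF F0.
have [c [c0 hc]] : exists c, 0 < c /\ forall x, box L x -> c <= F x.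
  have b0 : box L (0 : 'rV[R]_n) by move=> i; rewrite mxE normr0 ltW.
  have [||c cb hc] := @EVT_min_rV R n F (box L (k := n)) _ (@box_compact L n).
  - by exists 0.
  - exact: continuous_subspaceT.
  by exists (F c); split => // x /mem_set xb; exact: hc.
apply: (@lt_le_trans _ _ (ibox L (fun _ : 'rV[R]_n => c))).
  by rewrite ibox_cst ?ltW// mulr_gt0// exprn_gt0// pmulrn_lgt0.
by apply: le_ibox => //; [exact: ltW|exact: contC].
Qed.

End BoxIntegral.

(** * Directional derivatives and differentiation under the integral *)

Section Derivatives.
Variable R : realType.

(** A directional derivative sees only the values on one line, so a single transport lemma serves
    slices, fibres and compositions alike. *)
Lemma is_derive_line (V V' : normedModType R) (f : V -> R) (g : V' -> R)
    (a v : V) (b w : V') (d : R) :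
  (forall h : R, f (h *: v + a) = g (h *: w + b)) ->
  is_derive a v f d -> is_derive b w g d.
Proof.
move=> fg [df <-].
have e : (fun h : R => h^-1 *: ((f \o shift a) (h *: v) - f a)) =
         (fun h : R => h^-1 *: ((g \o shift b) (h *: w) - g b)).
  apply/funext => h /=; rewrite fg; congr (_ *: (_ - _)).
  by have := fg 0; rewrite !scale0r !add0r.
by split; [rewrite /derivable -e|rewrite /derive -e].
Qed.

Lemma is_derive_cvg (V : normedModType R) (f : V -> R) (a v : V) (d : R) :
  h^-1 *: (f (h *: v + a) - f a) @[h --> 0^'] --> d -> is_derive a v f d.
Proof.
move=> h; split; first by apply/cvg_ex; exists d.
exact/cvg_lim.
Qed.

Lemma is_derive_congr (V : normedModType R) (f g : V -> R) (x v : V) (d d' : R) :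
  is_derive x v f d -> f =1 g -> d = d' -> is_derive x v g d'.
Proof. by move=> df /funext <- <-. Qed.

Lemma is_derive_consV_head k (F : 'rV[R]_k.+1 -> R) (t : R) v d :
  is_derive (consV t v) (delta_mx 0 0) F d ->
  is_derive t 1 (fun t => F (consV t v)) d.
Proof.
apply: is_derive_line => h; congr F.
by rewrite -consV_addl scaler1.
Qed.

Lemma is_derive_consV_lift k (F : 'rV[R]_k.+1 -> R) (t : R) v i d :
  is_derive (consV t v) (delta_mx 0 (lift 0 i)) F d ->
  is_derive v (delta_mx 0 i) (fun v => F (consV t v)) d.
Proof.
apply: is_derive_line => h; congr F.
by rewrite consV_addr consV_delta.
Qed.

(** A mean value estimate with an explicit error, so that it can be made uniform over the fibre
    variable when differentiating an integral. *)
Lemma mean_value_approx (f df : R -> R) (t s c e : R) :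
  (forall x, `|x - t| <= `|s| -> is_derive x 1 f (df x)) ->
  (forall x, `|x - t| <= `|s| -> `|df x - c| <= e) ->
  `|f (s + t) - f t - s * c| <= e * `|s|.
Proof.
move=> fdf dfc.
have key a b : a <= b -> (forall x, a <= x <= b -> `|x - t| <= `|s|) ->
    `|f b - f a - (b - a) * c| <= e * (b - a).
  move=> ab abs.
  have H x : x \in `]a, b[ -> is_derive x 1 f (df x).
    by rewrite in_itv/= => /andP[/ltW ax /ltW xb]; apply/fdf/abs; rewrite ax xb.
  have cf : {within `[a, b], continuous f}.
    apply: derivable_within_continuous => x; rewrite in_itv/= => xab.
    by have [] := fdf x (abs _ xab).
  have [x] := MVT_segment ab H cf; rewrite in_itv/= => xab ->.
  have -> : df x * (b - a) - (b - a) * c = (df x - c) * (b - a) by ring.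
  rewrite normrM [X in _ * X]ger0_norm ?subr_ge0//.
  by rewrite ler_wpM2r ?subr_ge0// dfc// abs.
have [s0|s0] := leP 0 s.
  have := key t (s + t); rewrite lerDr addrK ger0_norm//; apply => // x.
  by move=> /andP[tx xs]; rewrite ger0_norm ?subr_ge0// lerBlDr.
have := key (s + t) t; rewrite gerDr ltW// ltr0_norm// opprD addrCA subrr addr0.
have -> : f t - f (s + t) - - s * c = - (f (s + t) - f t - s * c) by ring.
rewrite normrN; apply => // x /andP[xs tx].
by rewrite ler0_norm ?subr_le0// opprB lerBlDl addrC -lerBlDl opprK addrC.
Qed.

Lemma is_derive_ibox (L : R) n (F DF : 'rV[R]_n.+1 -> R) (t : R) : 0 <= L ->
  continuous F -> continuous DF ->
  (forall x, is_derive x (delta_mx 0 0) F (DF x)) ->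
  is_derive t 1 (fun t => ibox L (fun v => F (consV t v)))
    (ibox L (fun v => DF (consV t v))).
Proof.
move=> L0 cF cDF dF; apply: is_derive_cvg; apply/cvgrPdist_le => e e0.
pose d := e / ((L *+ 2) ^+ n + 1).
have p0 : 0 <= (L *+ 2) ^+ n by rewrite exprn_ge0// mulrn_wge0.
have d0 : 0 < d by rewrite divr_gt0// ltr_wpDl.
have dp : d * (L *+ 2) ^+ n <= e.
  rewrite /d mulrAC ler_pdivrMr ?ltr_wpDl// ler_wpM2l ?(ltW e0)//.
  by rewrite lerDl.
(* The bound is required at every [x] within [|h|] of [t], because the intermediate point of the
   mean value theorem depends on [v]. *)
have : \forall h \near (0 : R), forall v : 'rV[R]_n, box L v ->
    forall x, `|x - t| <= `|h| -> `|DF (consV x v) - DF (consV t v)| <= d.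
  apply: (@near_box R L n R (nbhs (0 : R)) (fun h v => forall x,
    `|x - t| <= `|h| -> `|DF (consV x v) - DF (consV t v)| <= d)) => v _.
  have c1 : continuous (fun p : 'rV[R]_n * R =>
      DF (consV p.2 p.1) - DF (consV t p.1)).
    apply: contB; apply: cont_comp => //; apply: continuous_consV.
    - by move=> p; exact: cvg_snd.
    - by move=> p; exact: cvg_fst.
    - exact: contC.
    - by move=> p; exact: cvg_fst.
  have /cvgrPdist_le := c1 (v, t) => /(_ _ d0) [[A B] /= [vA]].
  move=> /nbhs_ballP[r /= r0 tB] AB.
  exists (A, ball 0 r) => /=; first by split => //; exact: nbhsx_ballx.
  move=> [v' h] /= [Av']; rewrite /ball/= sub0r normrN => hr x xth.
  have := AB (v', x); rewrite /= !subrr sub0r normrN; apply; split => //.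
  by apply: tB; rewrite /ball/= distrC (le_lt_trans xth).
move=> H; near=> h.
have h0 : h != 0 by near: h; exact: nbhs_dnbhs_neq.
have Hh : forall v : 'rV[R]_n, box L v ->
    forall x, `|x - t| <= `|h| -> `|DF (consV x v) - DF (consV t v)| <= d.
  by near: h; exact: nbhs_dnbhs.
have hn0 : 0 < `|h| by rewrite normr_gt0.
rewrite scaler1.
have -> : ibox L (fun v => DF (consV t v)) - h^-1 *:
    (ibox L (fun v => F (consV (h + t) v)) - ibox L (fun v => F (consV t v))) =
  - h^-1 * (ibox L (fun v => F (consV (h + t) v)) -
     ibox L (fun v => F (consV t v) + h * DF (consV t v))).
  rewrite ibox_addM//; [|exact: continuous_fiber|exact: continuous_fiber].
  by rewrite /GRing.scale/=; field.
rewrite normrM normrN normfV mulrC ler_pdivrMr//.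
apply: (@le_trans _ _ ((d * `|h|) * (L *+ 2) ^+ n)); last first.
  by rewrite mulrAC ler_wpM2r.
apply: ibox_distance => //.
- exact: continuous_fiber.
- by apply: contD; [exact: continuous_fiber|apply: contM; [exact: contC|exact: continuous_fiber]].
move=> v vL; rewrite opprD addrA.
apply: (@mean_value_approx (fun t => F (consV t v)) (fun t => DF (consV t v))).
  by move=> x _; apply: is_derive_consV_head.
by move=> x xh; exact: Hh.
Unshelve. all: by end_near. Qed.

End Derivatives.

(** * Primitives on an interval *)

Section Primitive.
Variable R : realType.
Local Notation mu := (@lebesgue_measure R).

Lemma primitive_cc (f : R -> R) (L : R) : 0 < L -> continuous f ->
  exists Q : R -> R, [/\ Q (- L) = 0, Q L = \int[mu]_(t in `[- L, L]) f t &
    forall t, - L <= t <= L -> is_derive t 1 Q (f t)].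
Proof.
(* Starting at -L - 1 (and stopping at L + 1 below) makes -L and L interior points, where the
   primitive has a two-sided derivative. *)
move=> L0 cf; pose P t := \int[mu]_(s in `[- L - 1, t]) f s.
exists (fun t => P t - P (- L)); split; first by rewrite subrr.
  rewrite /P Rintegral_itvB ?bnd_simp; [|exact: continuous_integrable_cc|lra|lra].
  by apply: Rintegral_itv_obnd_cbnd; apply: integrableS (continuous_integrable_cc (- L) L cf) => //;
    exact: subset_itv_oc_cc.
move=> t /andP[Lt tL].
have tL1 : t < L + 1 by lra.
have Lt1 : - L - 1 < t by lra.
have [dP P'] := continuous_FTC1_closed tL1
  (continuous_integrable_cc (- L - 1) (L + 1) cf) Lt1 (cf t).
have dP1 : is_derive t 1 P (f t) by split; [exact: dP|rewrite -derive1E P'].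
by rewrite -[f t]subr0; apply: is_deriveB.
Qed.

(** With [Q] a primitive of [D], the function [Q - G] has nonnegative derivative, so one use of the
    mean value theorem compares its end values. *)
Lemma boundary_le_integral (D G G' : R -> R) (L : R) : 0 < L -> continuous D ->
  (forall t, - L <= t <= L -> is_derive t 1 G (G' t)) ->
  (forall t, - L <= t <= L -> G' t <= D t) ->
  G L - G (- L) <= \int[mu]_(t in `[- L, L]) D t.
Proof.
move=> L0 cD dG GD; have [Q [QL <- dQ]] := primitive_cc L0 cD.
have dQG t : - L <= t <= L -> is_derive t 1 (fun t => Q t - G t) (D t - G' t).
  by move=> tL; have h1 := dQ _ tL; have h2 := dG _ tL; apply: is_deriveB.
have LL : - L <= L by lra.
have [||c] := MVT_segment LL (f := fun t => Q t - G t) (df := fun t => D t - G' t).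
- by move=> t; rewrite in_itv/= => /andP[/ltW Lt /ltW tL]; apply: dQG; rewrite Lt tL.
- apply: derivable_within_continuous => t; rewrite in_itv/= => tL.
  by have [] := dQG _ tL.
rewrite in_itv/= => cL; rewrite QL => h.
have := GD _ cL; rewrite -subr_ge0 => h0.
have : 0 <= (D c - G' c) * (L - - L) by rewrite mulr_ge0//; lra.
by rewrite -h; lra.
Qed.

End Primitive.

Section Chain.
Variable R : realType.

Lemma is_derive_chain (V : normedModType R) (U : V -> R) (g : R -> R) (x v : V) (d d' : R) :
  is_derive x v U d -> is_derive (U x) 1 g d' ->
  is_derive x v (fun y => g (U y)) (d' * d).
Proof.
move=> dU dg.
have dl : is_derive (0 : R) (1 : R) (fun h : R => U (h *: v + x)) d.
  by apply: is_derive_line dU => h; rewrite addr0 scaler1.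
have dg' : is_derive (U ((0 : R) *: v + x)) 1 g d' by rewrite scale0r add0r.
have := is_derive1_comp (f := g) dg' dl; apply: is_derive_line => h /=.
by rewrite addr0 scaler1.
Qed.

Lemma is_derive_continuous (f : R -> R) (x d : R) : is_derive x 1 f d ->
  {for x, continuous f}.
Proof. by case=> /derivable1_diffP df _; exact: differentiable_continuous. Qed.

Lemma cont_comp_for (T : topologicalType) (U : T -> R) (g : R -> R) :
  continuous U -> (forall x, {for U x, continuous g}) ->
  continuous (fun x => g (U x)).
Proof. by move=> cU cg x; apply: (@cvg_comp _ _ _ U g _ _ _ (cU x)); exact: cg. Qed.

Lemma contV (T : topologicalType) (f : T -> R) : (forall x, f x != 0) ->
  continuous f -> continuous (fun x => (f x)^-1).
Proof. by move=> f0 cf x; apply: cvgV; [exact: f0|exact: cf]. Qed.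

End Chain.

(** * One-variable derivatives for the induction step *)

Section OneVariable.
Variable R : realType.

(** For [tau = - F / S] this is the equation (tau S)' = - q solved for tau'; the quotient is kept in
    the result so that the equation can be read back. *)
Lemma is_derive_neg_quotient (F S : R -> R) (t q s : R) : S t != 0 ->
  is_derive t 1 F q -> is_derive t 1 S s ->
  is_derive t 1 (fun t => - F t * (S t)^-1) (- (q + - F t * (S t)^-1 * s) / S t).
Proof.
move=> S0 dF dS.
have dV : is_derive t 1 (fun t => (S t)^-1) (- S t ^- 2 *: s).
  by have := @is_deriveV R S t s 1 S0 dS.
have dN : is_derive t 1 (fun t => - F t) (- q) by exact: is_deriveN.
apply: (is_derive_congr (is_deriveM dN dV)) => //.
by rewrite /GRing.scale/=; field.
Qed.

(** To be used with [F], [O1] and [O] the fibre integrals of f rho(U), rho(U) DU_0 and phi(U). *)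
Lemma is_derive_boundary_term (tau F O1 O : R -> R) (m t tau' F' O2 : R) :
  is_derive t 1 tau tau' -> is_derive t 1 F F' -> is_derive t 1 O1 O2 ->
  is_derive t 1 O (O1 t) ->
  is_derive t 1 (fun t => 2 * (tau t * F t) + tau t ^+ 2 * O1 t + 2 * m * (tau t * O t))
   (2 * (tau' * F t + tau t * F') + (2 * tau t * tau' * O1 t + tau t ^+ 2 * O2)
  + 2 * m * (tau' * O t + tau t * O1 t)).
Proof.
move=> dtau dF dO1 dO.
have d1 := is_deriveM dtau dF.
have d2 := is_deriveM (is_deriveM dtau dtau) dO1.
have d3 := is_deriveM dtau dO.
apply: (is_derive_congr (is_deriveD (is_deriveD (is_deriveZ 2 d1) d2)
  (is_deriveZ (2 * m) d3))) => //.
rewrite /GRing.scale/=.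
have -> : (tau * tau) t = tau t * tau t by [].
ring.
Qed.

End OneVariable.

(** * The weighted inequality on a box, by induction on the dimension *)

Section BoxInequality.
Variables (R : realType) (L : R) (L0 : 0 < L).
Variables (phi rho drho : R -> R) (dom : set R).
Variables (a : nat -> R) (adm : nat -> R -> Prop).
Hypothesis dphi : forall s, dom s -> is_derive s 1 phi (rho s).
Hypothesis dvrho : forall s, dom s -> is_derive s 1 rho (drho s).
Hypothesis cdrho : forall s, dom s -> {for s, continuous drho}.
Hypothesis rho_gt0 : forall s, dom s -> 0 < rho s.
Hypothesis drho_gt0 : forall s, dom s -> 0 < drho s.
Hypothesis a0_phi : forall s, dom s -> a 0 * phi s <= rho s ^+ 2 / drho s.
Hypothesis a_step : forall n m s u, dom u -> adm n.+1 m ->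
  adm n (m + s) /\
  a n.+1 * m ^+ 2 * phi u <= (a n * (m + s) ^+ 2 - 2 * m * s) * phi u.

Local Notation th := (fun u => rho u ^+ 2 / drho u).

(* Majorizing the dual form of [- D^2 U] by an arbitrary function [e] avoids inverting
   Hessians in the induction.  The scalar [m] is the divergence of the triangular
   field in the coordinates already treated; [a n] measures what the remaining [n]
   coordinates can still contribute. *)
Theorem box_inequality n (U : 'rV[R]_n -> R) (DU : 'I_n -> 'rV[R]_n -> R)
    (D2U : 'I_n -> 'I_n -> 'rV[R]_n -> R) (f : 'rV[R]_n -> R)
    (Df : 'I_n -> 'rV[R]_n -> R) (e h : 'rV[R]_n -> R) (m : R) :
  (forall x, dom (U x)) ->
  continuous U -> (forall i, continuous (DU i)) ->
  (forall i j, continuous (D2U i j)) ->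
  (forall i x, is_derive x (delta_mx 0 i) U (DU i x)) ->
  (forall i j x, is_derive x (delta_mx 0 i) (DU j) (D2U i j x)) ->
  (forall i j x, D2U i j x = D2U j i x) ->
  continuous f -> (forall i, continuous (Df i)) ->
  (forall i x, is_derive x (delta_mx 0 i) f (Df i x)) ->
  continuous e -> continuous h ->
  (forall x (w : 'I_n -> R), 2 * (\sum_i w i * Df i x) +
     \sum_i \sum_j w i * w j * D2U i j x <= e x) ->
  ibox L (fun x => h x * rho (U x)) = 0 -> adm n m ->
  0 <= ibox L (fun x => e x * rho (U x) - 2 * (f x * h x * rho (U x))
     + th (U x) * (h x - m) ^+ 2 - a n * m ^+ 2 * phi (U x)).
Proof.
elim: n => [|n IH] in U DU D2U f Df e h m *;
  move=> domU cU cDU cD2U dU dDU symU cf cDf df ce ch he hrho admm.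
  rewrite /= in hrho *.
  have h0 : h 0 = 0.
    by move/eqP : hrho; rewrite mulf_eq0 (gt_eqF (rho_gt0 (domU _))) orbF => /eqP.
  (* In dimension 0 the mean condition forces h = 0; [e] is nonnegative by testing with the empty
     vector, and the rest is [a0_phi] multiplied by m^2. *)
  have := he 0 (fun=> 0); rewrite !big_ord0 mulr0 addr0 => e0.
  have := a0_phi (domU 0); rewrite -subr_ge0 => a0.
  rewrite h0 !(mulr0, mul0r) subr0 sub0r sqrrN.
  have r0 := rho_gt0 (domU 0).
  have : 0 <= (rho (U 0) ^+ 2 / drho (U 0) - a 0 * phi (U 0)) * m ^+ 2.
    by rewrite mulr_ge0// sqr_ge0.
  have : 0 <= e 0 * rho (U 0) by rewrite mulr_ge0// ltW.
  by move: (rho _ ^+ 2 / _) => x; lra.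
have L0' := ltW L0.
have crho : continuous (fun x => rho (U x)).
  by apply: cont_comp_for => // x; apply: is_derive_continuous; exact: dvrho.
have cphi : continuous (fun x => phi (U x)).
  by apply: cont_comp_for => // x; apply: is_derive_continuous; exact: dphi.
have cdr : continuous (fun x => drho (U x)).
  by apply: cont_comp_for => // x; exact: cdrho.
have dr0 x : drho (U x) != 0 by rewrite gt_eqF// drho_gt0.
have r0 x : rho (U x) != 0 by rewrite gt_eqF// rho_gt0.
have dU0 x : is_derive x (delta_mx 0 0) U (DU 0 x) by [].
have drhoU x : is_derive x (delta_mx 0 0) (fun x => rho (U x)) (drho (U x) * DU 0 x).
  by apply: is_derive_chain => //; exact: dvrho.
have dphiU x : is_derive x (delta_mx 0 0) (fun x => phi (U x)) (rho (U x) * DU 0 x).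
  by apply: is_derive_chain => //; exact: dphi.
(* [I1] integrates over the slice at [t]. In the first coordinate, [XR], [X1], [X3] and [X2] are the
   derivatives of [Xr], [X0], [Xp] and [X3]. *)
pose I1 (F : 'rV[R]_n.+1 -> R) (t : R) := ibox L (fun v => F (consV t v)).
pose Xr x := rho (U x).
pose Xp x := phi (U x).
pose Xh x := h x * rho (U x).
pose XR x := drho (U x) * DU 0 x.
pose X0 x := f x * rho (U x).
pose X1 x := Df 0 x * rho (U x) + f x * (drho (U x) * DU 0 x).
pose X2 x := drho (U x) * DU 0 x * DU 0 x + rho (U x) * D2U 0 0 x.
pose X3 x := rho (U x) * DU 0 x.
have cXh : continuous Xh by exact: contM.
have cXR : continuous XR by exact: contM.
have cX0 : continuous X0 by exact: contM.
have cX1 : continuous X1 by apply: contD; apply: contM => //; exact: contM.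
have cX3 : continuous X3 by exact: contM.
have cX2 : continuous X2 by apply: contD; apply: contM => //; exact: contM.
have dX0 x : is_derive x (delta_mx 0 0) X0 (X1 x).
  have h1 := drhoU x; have h2 := df 0 x.
  by apply: is_derive_eq; rewrite /X1 /GRing.scale/=; ring.
have dX3 x : is_derive x (delta_mx 0 0) X3 (X2 x).
  have h1 := drhoU x; have h2 := dDU 0 0 x.
  by apply: is_derive_eq; rewrite /X2 /GRing.scale/=; ring.
have dR (t : R) : is_derive t 1 (I1 Xr) (I1 XR t) by exact: is_derive_ibox.
have dF (t : R) : is_derive t 1 (I1 X0) (I1 X1 t) by exact: is_derive_ibox.
have dO (t : R) : is_derive t 1 (I1 Xp) (I1 X3 t) by exact: is_derive_ibox.
have dO1 (t : R) : is_derive t 1 (I1 X3) (I1 X2 t) by exact: is_derive_ibox.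
have [Q [QL0 QL dQ]] := primitive_cc L0 (continuous_ibox L0' cXh).
have {}QL : Q L = 0 by rewrite QL -[RHS]hrho.
pose Rt := I1 Xr.
have Rt0 t : Rt t != 0.
  rewrite gt_eqF//; apply: ibox_gt0 => //; first exact: (continuous_fiber (F := Xr)).
  by move=> v; exact: rho_gt0.
(* [tau] solves [(tau Rt)' = - I1 Xh] and vanishes at both ends of the interval. *)
pose tau (t : R) : R := - Q t * (Rt t)^-1.
pose tau' (t : R) : R := - (I1 Xh t + tau t * I1 XR t) / Rt t.
have dtau (t : R) : - L <= t <= L -> is_derive t 1 tau (tau' t).
  by move=> tL; have := is_derive_neg_quotient (Rt0 t) (dQ _ tL) (dR t).
pose K x := e x * rho (U x) - 2 * (f x * h x * rho (U x))
     + th (U x) * (h x - m) ^+ 2 - a n.+1 * m ^+ 2 * phi (U x).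
have cth : continuous (fun x => th (U x)).
  by apply: contM; [exact: contX|exact: contV].
have cK : continuous K.
  exact: (contB (contD (contB (contM ce crho)
    (contM (@contC _ _ _) (contM (contM cf ch) crho)))
    (contM cth (contX (contB ch (@contC _ _ _))))) (contM (@contC _ _ _) cphi)).
(* [G] is the boundary term of the integration by parts in [t]. It vanishes with [tau] at both ends,
   so it is enough to show [G' <= I1 K] slice by slice. *)
pose G (t : R) : R := 2 * (tau t * I1 X0 t) + tau t ^+ 2 * I1 X3 t
  + 2 * m * (tau t * I1 Xp t).
pose G' (t : R) : R := 2 * (tau' t * I1 X0 t + tau t * I1 X1 t)
  + (2 * tau t * tau' t * I1 X3 t + tau t ^+ 2 * I1 X2 t)
  + 2 * m * (tau' t * I1 Xp t + tau t * I1 X3 t).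
have dG (t : R) : - L <= t <= L -> is_derive t 1 G (G' t).
  move=> /dtau h1.
  by have := is_derive_boundary_term m h1 (dF t) (dO1 t) (dO t).
have G0 : G L - G (- L) = 0.
  by rewrite /G /tau QL QL0 oppr0 !(mul0r, mulr0, expr0n)/=; ring.
suff GK : G L - G (- L) <= ibox L K by rewrite G0 in GK; exact: GK.
apply: (@boundary_le_integral R (I1 K) G G' L) => //.
  exact: continuous_ibox.
move=> t tL.
pose Uv v := U (consV t v).
(* On the slice the first component of the field is the constant [T]. Then [h2] is what the other
   components must still produce, of mean zero on the slice by the equation for [tau]; [e2] is the
   majorant once the first test component is fixed at [T]; and [f2] absorbs the mixed second
   derivatives of U. *)
pose T := tau t; pose T' := tau' t.
pose h2 x := h x + T' + T * (drho (U x) / rho (U x) * DU 0 x).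
pose e2 x := e x - 2 * T * Df 0 x - T ^+ 2 * D2U 0 0 x.
pose f2 x := f x + T * DU 0 x.
have ch2 : continuous h2.
  apply: contD; first by apply: contD => //; exact: contC.
  by apply: contM; [exact: contC|repeat apply: contM => //; exact: contV].
have ce2 : continuous e2.
  exact: (contB (contB ce (contM (@contC _ _ _) (cDf 0))) (contM (@contC _ _ _) (cD2U 0 0))).
have cf2 : continuous f2 by apply: contD => //; apply: contM => //; exact: contC.
have cfib (F : 'rV[R]_n.+1 -> R) : continuous F -> continuous (fun v => F (consV t v)).
  exact: continuous_fiber.
have fXh := cfib _ cXh.
have fXr := cfib _ crho.
have fXR := cfib _ cXR.
have fX0 := cfib _ cX0.
have fX1 := cfib _ cX1.
have fX2 := cfib _ cX2.
have fX3 := cfib _ cX3.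
have fXp := cfib _ cphi.
have fK := cfib _ cK.
have mean0 : ibox L (fun v => h2 (consV t v) * rho (Uv v)) = 0.
  transitivity (I1 Xh t + T' * Rt t + T * I1 XR t).
    rewrite /Rt /I1 -!ibox_addM//; last first.
      by apply: contD => //; apply: contM => //; exact: contC.
    apply: eq_ibox => v; rewrite /h2 /XR /Uv /Xh /Xr.
    by have := r0 (consV t v) => ?; field.
  by rewrite /T' /tau' -/T mulfVK//; ring.
have [admn _] := a_step T' (domU (consV t 0)) admm.
(* Test [he] with [w] completed by [T] in front: the mixed entries occur twice, by symmetry, and
   supply the gradient of [T * DU 0] inside [f2]. *)
have IHe : forall v (w : 'I_n -> R), 2 * (\sum_i w i * (Df (lift 0 i) (consV t v)
      + T * D2U (lift 0 i) 0 (consV t v))) +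
     \sum_i \sum_j w i * w j * D2U (lift 0 i) (lift 0 j) (consV t v)
     <= e2 (consV t v).
  move=> v w; have := he (consV t v) (fun i => if unlift 0 i is Some j then w j else T).
  rewrite !big_ord_recl /= unlift_none.
  under eq_bigr do rewrite liftK.
  under [X in _ + (_ + X + _)]eq_bigr do rewrite liftK.
  under [X in _ + (_ + X)]eq_bigr do rewrite big_ord_recl /= unlift_none liftK.
  rewrite big_split/=.
  under [X in _ + (_ + (_ + X))]eq_bigr do under eq_bigr do rewrite liftK.
  rewrite /e2.
  have -> : \sum_(i < n) T * w i * D2U 0 (lift 0 i) (consV t v)
     = T * \sum_i w i * D2U (lift 0 i) 0 (consV t v).
    by rewrite mulr_sumr; apply: eq_bigr => i _; rewrite symU; ring.
  have -> : \sum_(i < n) w i * T * D2U (lift 0 i) 0 (consV t v)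
     = T * \sum_i w i * D2U (lift 0 i) 0 (consV t v).
    by rewrite mulr_sumr; apply: eq_bigr => i _; ring.
  under [X in _ -> 2 * X + _ <= _]eq_bigr do rewrite mulrDr mulrCA.
  rewrite [X in _ -> 2 * X + _ <= _]big_split/= -mulr_sumr.
  lra.
pose K2 v := e2 (consV t v) * rho (Uv v) - 2 * (f2 (consV t v) * h2 (consV t v) * rho (Uv v)) +
     rho (Uv v) ^+ 2 / drho (Uv v) * (h2 (consV t v) - (m + T')) ^+ 2 -
     a n * (m + T') ^+ 2 * phi (Uv v).
have fe2 := cfib _ ce2.
have ff2 := cfib _ cf2.
have fh2 := cfib _ ch2.
have fth := cfib _ cth.
have cK2 : continuous K2.
  exact: (contB (contD (contB (contM fe2 fXr)
    (contM (@contC _ _ _) (contM (contM ff2 fh2) fXr)))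
    (contM fth (contX (contB fh2 (@contC _ _ _))))) (contM (@contC _ _ _) fXp)).
have IHK : 0 <= ibox L K2.
  apply: (IH Uv (fun j v => DU (lift 0 j) (consV t v))
    (fun i j v => D2U (lift 0 i) (lift 0 j) (consV t v))
    (fun v => f2 (consV t v)) (fun j v => Df (lift 0 j) (consV t v) + T * D2U (lift 0 j) 0 (consV t v))
    (fun v => e2 (consV t v)) (fun v => h2 (consV t v)) (m + T')) => //.
  - by move=> v; exact: domU.
  - exact: (cfib U).
  - by move=> i; exact: (cfib (DU (lift 0 i))).
  - by move=> i j; exact: (cfib (D2U (lift 0 i) (lift 0 j))).
  - by move=> i v; exact: is_derive_consV_lift.
  - by move=> i j v; exact: is_derive_consV_lift.
  - move=> i; apply: (cfib (fun x => Df (lift 0 i) x + T * D2U (lift 0 i) 0 x)).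
    by apply: contD => //; apply: contM => //; exact: contC.
  - move=> i v.
    have h1 := df (lift 0 i) (consV t v).
    have h3 := is_deriveZ T (dDU (lift 0 i) 0 (consV t v)).
    exact: (is_derive_consV_lift (is_deriveD h1 h3)).
(* This is where the weight rho^2 / drho is used: expanding its square produces [2 T rho DU_0 h],
   which cancels the same term coming from [f2 * h2]. Hence the corrections no longer contain h, and
   they match [G'] up to the [phi] term treated by [a_step]. *)
have KE : I1 K t = ibox L K2 + (2 * T') * I1 X0 t + (2 * T) * I1 X1 t + T ^+ 2 * I1 X2 t
   + (2 * T * (m + T')) * I1 X3 t
   + (a n * (m + T') ^+ 2 - a n.+1 * m ^+ 2) * I1 Xp t.
  have s1 := contD cK2 (contM (@contC _ _ (2 * T')) fX0).
  have s2 := contD s1 (contM (@contC _ _ (2 * T)) fX1).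
  have s3 := contD s2 (contM (@contC _ _ (T ^+ 2)) fX2).
  have s4 := contD s3 (contM (@contC _ _ (2 * T * (m + T'))) fX3).
  rewrite /I1 -(ibox_addM L0' _ cK2 fX0) -(ibox_addM L0' _ s1 fX1) -(ibox_addM L0' _ s2 fX2).
  rewrite -(ibox_addM L0' _ s3 fX3) -(ibox_addM L0' _ s4 fXp).
  apply: eq_ibox => v.
  rewrite /K /K2 /X0 /X1 /X2 /X3 /Xp /e2 /f2 /h2 /Uv.
  have := r0 (consV t v); have := dr0 (consV t v).
  move: (rho _) (drho _) (phi _) => r dr p dr00 r00.
  by field; rewrite dr00 r00.
have phiE : a n.+1 * m ^+ 2 * I1 Xp t <= (a n * (m + T') ^+ 2 - 2 * m * T') * I1 Xp t.
  rewrite /I1 -!iboxZ//; apply: le_ibox => // [||v _].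
  - by apply: contM => //; exact: contC.
  - by apply: contM => //; exact: contC.
  by have [_] := a_step T' (domU (consV t v)) admm.
rewrite KE /G' -/T -/T'.
move: phiE IHK; move: (I1 Xp t) (I1 X3 t) (I1 X2 t) (I1 X1 t) (I1 X0 t) (ibox L K2).
move=> p x3 x2 x1 x0 k pE k0.
lra.
Qed.

End BoxInequality.

(** * Reduction of the integral over the whole space to a box *)

Section IteratedIntegral.
Variable R : realType.

Lemma iint_ibox (L : R) n (F : 'rV[R]_n -> R) : 0 <= L -> continuous F ->
  (forall x, ~ box L x -> F x = 0) ->
  iint (fun x => (F x)%:E) = (ibox L F)%:E.
Proof.
move=> L0; elim: n => [//|n IH] in F *; move=> cF F0 /=.
pose g t := ibox L (fun v => F (consV t v)).
under eq_integral => t _.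
  have -> : iint (fun v => (F (row_mx (const_mx t : 'rV_1) v))%:E) = (g t)%:E.
    apply: IH; first exact: (@continuous_fiber R n F t).
    move=> v vL; apply: F0 => h; apply: vL => i.
    by have := h (lift 0 i); rewrite consV_lift.
  over.
have cg : continuous g by exact: continuous_ibox.
have ig := continuous_integrable_cc (- L) L cg.
rewrite /Rintegral fineK; last exact: integrable_fin_num.
rewrite [RHS]integral_mkcond; apply: eq_integral => t _.
rewrite patchE; case: ifPn => // tL.
have -> // : g t = 0.
rewrite /g (_ : (fun v => _) = fun=> 0) ?ibox_cst ?mul0r//.
apply/funext => v; apply: F0 => /(_ 0); rewrite consV_head => h.
by move: tL; rewrite notin_setE/= in_itv/= -ler_norml h.
Qed.

End IteratedIntegral.

(** * The Brascamp-Lieb form of the box inequality *)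

Section BoxBrascampLieb.
Variables (R : realType) (L : R) (L0 : 0 < L).
Variables (phi rho drho : R -> R) (dom : set R).
Variables (a : nat -> R) (adm : nat -> R -> Prop).
Hypothesis dphi : forall s, dom s -> is_derive s 1 phi (rho s).
Hypothesis dvrho : forall s, dom s -> is_derive s 1 rho (drho s).
Hypothesis cdrho : forall s, dom s -> {for s, continuous drho}.
Hypothesis rho_gt0 : forall s, dom s -> 0 < rho s.
Hypothesis drho_gt0 : forall s, dom s -> 0 < drho s.
Hypothesis a0_phi : forall s, dom s -> a 0 * phi s <= rho s ^+ 2 / drho s.
Hypothesis a_step : forall n m s u, dom u -> adm n.+1 m ->
  adm n (m + s) /\
  a n.+1 * m ^+ 2 * phi u <= (a n * (m + s) ^+ 2 - 2 * m * s) * phi u.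

Theorem box_brascamp_lieb n (U : 'rV[R]_n -> R) (DU : 'I_n -> 'rV[R]_n -> R)
    (D2U : 'I_n -> 'I_n -> 'rV[R]_n -> R) (f : 'rV[R]_n -> R)
    (Df : 'I_n -> 'rV[R]_n -> R) (e : 'rV[R]_n -> R) :
  (forall x, dom (U x)) ->
  continuous U -> (forall i, continuous (DU i)) ->
  (forall i j, continuous (D2U i j)) ->
  (forall i x, is_derive x (delta_mx 0 i) U (DU i x)) ->
  (forall i j x, is_derive x (delta_mx 0 i) (DU j) (D2U i j x)) ->
  (forall i j x, D2U i j x = D2U j i x) ->
  continuous f -> (forall i, continuous (Df i)) ->
  (forall i x, is_derive x (delta_mx 0 i) f (Df i x)) ->
  continuous e ->
  (forall x (w : 'I_n -> R), 2 * (\sum_i w i * Df i x) +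
     \sum_i \sum_j w i * w j * D2U i j x <= e x) ->
  adm n 0 ->
  ibox L (fun x => f x * drho (U x)) = 0 ->
  ibox L (fun x => f x ^+ 2 * drho (U x)) <= ibox L (fun x => e x * rho (U x)).
Proof.
move=> domU cU cDU cD2U dU dDU symU cf cDf df ce he adm0 f0.
have crho : continuous (fun x => rho (U x)).
  by apply: cont_comp_for => // x; apply: is_derive_continuous; exact: dvrho.
have cdr : continuous (fun x => drho (U x)).
  by apply: cont_comp_for => // x; exact: cdrho.
have dr0 x : drho (U x) != 0 by rewrite gt_eqF// drho_gt0.
have r0 x : rho (U x) != 0 by rewrite gt_eqF// rho_gt0.
(* This [h] minimizes [- 2 f h rho + (rho^2 / drho) h^2] pointwise; the minimum is [- f^2 drho]. *)
pose h x := f x * drho (U x) / rho (U x).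
have ch : continuous h by apply: contM; [exact: contM|exact: contV].
have hm : ibox L (fun x => h x * rho (U x)) = 0.
  by rewrite -[RHS]f0; apply: eq_ibox => x; rewrite /h mulfVK.
have := box_inequality L0 dphi dvrho cdrho rho_gt0 drho_gt0 a0_phi a_step
  domU cU cDU cD2U dU dDU symU cf cDf df ce ch he hm adm0.
rewrite (_ : (fun x => _) = fun x => e x * rho (U x) - f x ^+ 2 * drho (U x)).
  rewrite iboxB ?subr_ge0//; [exact: ltW|exact: contM|].
  by apply: contM => //; exact: contX.
apply/funext => x; rewrite /h; have := r0 x; have := dr0 x.
move: (rho _) (drho _) => r dr ? ?; field; exact/andP.
Qed.

End BoxBrascampLieb.

(** * Continuity of determinants and inverse matrices *)

Section MatrixContinuity.
Variables (R : realType) (T : topologicalType).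

Lemma cvg_near_eq (f h : T -> R) (x : T) (l : R) :
  (\forall y \near x, f y = h y) -> h y @[y --> x] --> l -> f y @[y --> x] --> l.
Proof.
move=> fh; apply: cvg_trans; apply: near_eq_cvg.
by apply: filterS fh => y ->.
Qed.

Lemma cvg_sum_seq (F : set_system T) (I : Type) (r : seq I) (f : I -> T -> R) (l : I -> R) :
  Filter F -> (forall i, f i y @[y --> F] --> l i) ->
  \sum_(i <- r) f i y @[y --> F] --> \sum_(i <- r) l i.
Proof.
move=> FF fl; elim: r => [|i r IH].
  by rewrite big_nil; under eq_fun do rewrite big_nil; exact: cvg_cst.
by rewrite big_cons; under eq_fun do rewrite big_cons; exact: cvgD.
Qed.

Lemma cvg_prod_seq (F : set_system T) (I : Type) (r : seq I) (f : I -> T -> R) (l : I -> R) :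
  Filter F -> (forall i, f i y @[y --> F] --> l i) ->
  \prod_(i <- r) f i y @[y --> F] --> \prod_(i <- r) l i.
Proof.
move=> FF fl; elim: r => [|i r IH].
  by rewrite big_nil; under eq_fun do rewrite big_nil; exact: cvg_cst.
by rewrite big_cons; under eq_fun do rewrite big_cons; exact: cvgM.
Qed.

Lemma cvg_det (F : set_system T) n (A : T -> 'M[R]_n) (B : 'M[R]_n) : Filter F ->
  (forall i j, A y i j @[y --> F] --> B i j) -> \det (A y) @[y --> F] --> \det B.
Proof.
move=> FF AB; rewrite /determinant; apply: cvg_sum_seq => s.
by apply: cvgM; [exact: cvg_cst|apply: cvg_prod_seq => i; exact: AB].
Qed.

(** By the adjugate formula each entry of the inverse is a cofactor over the determinant; [invmx]
    agrees with the formula only on invertible matrices, hence the condition along the filter. *)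
Lemma cvg_invmx (F : set_system T) n (A : T -> 'M[R]_n) (B : 'M[R]_n) : Filter F ->
  (forall i j, A y i j @[y --> F] --> B i j) ->
  (\forall y \near F, A y \in unitmx) -> B \in unitmx ->
  forall i j, invmx (A y) i j @[y --> F] --> invmx B i j.
Proof.
move=> FF AB uA uB i j.
have dB : \det B != 0 by rewrite -unitfE -unitmxE.
have : (\det (A y))^-1 * \adj (A y) i j @[y --> F] --> invmx B i j.
  rewrite /invmx uB [X in _ --> X]mxE; apply: cvgM.
    by apply: cvgV => //; exact: cvg_det.
  rewrite [X in _ --> X]mxE; under eq_fun do rewrite mxE.
  rewrite /cofactor; apply: cvgM; first exact: cvg_cst.
  apply: cvg_det => k l.
  by rewrite !mxE; under eq_fun do rewrite !mxE; exact: AB.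
apply: cvg_trans; apply: near_eq_cvg; apply: filterS uA => y uy.
by rewrite /invmx uy [RHS]mxE.
Qed.

End MatrixContinuity.

(** * Quadratic forms and their duals *)

Section QuadraticForms.
Variable R : realType.

Definition qform n (H : 'M[R]_n) (w : 'I_n -> R) : R :=
  \sum_i \sum_j w i * w j * H i j.

Lemma qformE n (H : 'M[R]_n) (w : 'rV[R]_n) :
  (w *m H *m w^T) 0 0 = qform H (fun i => w 0 i).
Proof.
rewrite /qform mxE exchange_big/=; apply: eq_bigr => j _.
rewrite mxE mulr_suml mxE; apply: eq_bigr => i _; ring.
Qed.

Lemma dotE n (g w : 'rV[R]_n) : (w *m g^T) 0 0 = \sum_i w 0 i * g 0 i.
Proof. by rewrite mxE; apply: eq_bigr => i _; rewrite mxE. Qed.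

Lemma complete_square n (H : 'M[R]_n) (g w : 'rV[R]_n) (c : R) :
  H \in unitmx -> H^T = H ->
  ((w + c *: (g *m invmx H)) *m H *m (w + c *: (g *m invmx H))^T) 0 0 =
  (w *m H *m w^T) 0 0 + 2 * c * (w *m g^T) 0 0
  + c ^+ 2 * (g *m invmx H *m g^T) 0 0.
Proof.
move=> uH sH.
have -> : (w + c *: (g *m invmx H))^T = w^T + c *: (invmx H *m g^T).
  by rewrite linearD linearZ/= trmx_mul trmx_inv sH.
have gw : (g *m w^T) 0 0 = (w *m g^T) 0 0.
  by rewrite !dotE; apply: eq_bigr => i _; rewrite mulrC.
rewrite mulmxDl -scalemxAl mulmxKV// mulmxDr !mulmxDl.
rewrite -!scalemxAr -!scalemxAl mulmxA mulmxK// !mulmxA.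
rewrite !mxE; move: gw; rewrite !mxE => gw.
rewrite gw; ring.
Qed.

(** Completing the square at w + g H^-1 leaves a nonpositive remainder; the right side is the
    Legendre dual of the form. *)
Lemma le_quad_nsd n (H : 'M[R]_n) (g w : 'rV[R]_n) :
  H \in unitmx -> H^T = H -> (forall z : 'I_n -> R, qform H z <= 0) ->
  2 * (\sum_i w 0 i * g 0 i) + qform H (fun i => w 0 i) <= - (g *m invmx H *m g^T) 0 0.
Proof.
move=> uH sH pH; have := complete_square g w 1 uH sH.
have := pH (fun i => (w + 1 *: (g *m invmx H)) 0 i).
by rewrite -(qformE H (w + 1 *: (g *m invmx H))) => + e; rewrite e qformE (dotE g w); lra.
Qed.

(** If [w] is isotropic, the form along w + s z with z = w H has no constant term and has linear
    coefficient 2 |z|^2; staying nonnegative for every s forces z = 0. *)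
Lemma psd_unit_definite n (H : 'M[R]_n) (w : 'rV[R]_n) :
  H \in unitmx -> H^T = H -> (forall z : 'I_n -> R, 0 <= qform H z) ->
  qform H (fun i => w 0 i) = 0 -> w = 0.
Proof.
move=> uH sH pH w0; suff : w *m H = 0.
  by move=> /(congr1 (mulmx^~ (invmx H))); rewrite mulmxK// mul0mx.
apply/rowP => i; rewrite [RHS]mxE; apply/eqP.
pose z : 'rV[R]_n := w *m H.
have key s : 0 <= 2 * s * (z *m z^T) 0 0 + s ^+ 2 * (z *m H *m z^T) 0 0.
  have := pH (fun i => (w + s *: z) 0 i); rewrite -(qformE H (w + s *: z)).
  have -> : (w + s *: z)^T = w^T + s *: z^T by rewrite linearD linearZ.
  rewrite mulmxDl -scalemxAl mulmxDr !mulmxDl -!scalemxAr -!scalemxAl.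
  have zw : (z *m H *m w^T) 0 0 = (z *m z^T) 0 0.
    by rewrite /z trmx_mul sH !mulmxA.
  have zz : (w *m H *m z^T) 0 0 = (z *m z^T) 0 0 by [].
  move: w0 zw zz; rewrite -qformE !mxE => -> -> ->.
  by rewrite add0r; lra.
have zz0 : (z *m z^T) 0 0 = 0.
  set A := (z *m z^T) 0 0 in key *; set B := (z *m H *m z^T) 0 0 in key.
  have A0 : 0 <= A by rewrite /A (dotE z z) sumr_ge0// => j _; rewrite -expr2 sqr_ge0.
  apply/eqP; rewrite eq_le A0 andbT leNgt; apply/negP => Ap.
  have B0 : 0 <= B by rewrite /B qformE.
  (* A negative step, short enough for the linear term to beat the quadratic one; the 1 covers B =
     0. *)
  have := key (- A / (B + 1)).
  have B1 : 0 < B + 1 by rewrite ltr_wpDl.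
  have -> : 2 * (- A / (B + 1)) * A + (- A / (B + 1)) ^+ 2 * B =
     - (A / (B + 1)) ^+ 2 * (B + 2) by field; rewrite gt_eqF.
  have : 0 < (A / (B + 1)) ^+ 2 by rewrite exprn_gt0// divr_gt0.
  by move=> hp; rewrite mulNr oppr_ge0 leNgt mulr_gt0//; lra.
move: zz0; rewrite (dotE z z) => /eqP; rewrite psumr_eq0; last first.
  by move=> j _; rewrite -expr2 sqr_ge0.
by move=> /allP /(_ i (mem_index_enum _)); rewrite mulf_eq0 orbb.
Qed.

End QuadraticForms.

(** * Second differences and the symmetry of mixed derivatives *)

Section SecondDifference.
Variable R : realType.

(** The mean value theorem is used twice: in direction [p] on the difference of two parallel
    segments, then in direction [q] on [Wp]. *)
Lemma second_difference_mean_value (V : normedModType R) (W Wp Wpq : V -> R) (x p q : V) (s : R) :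
  0 <= s ->
  (forall a b, 0 <= a <= s -> 0 <= b <= s ->
    is_derive (a *: p + (b *: q + x)) p W (Wp (a *: p + (b *: q + x))) /\
    is_derive (b *: q + (a *: p + x)) q Wp (Wpq (b *: q + (a *: p + x)))) ->
  exists a b, [/\ 0 <= a <= s, 0 <= b <= s &
   W (s *: p + (s *: q + x)) - W (s *: p + x) - (W (s *: q + x) - W x) =
   Wpq (b *: q + (a *: p + x)) * s ^+ 2].
Proof.
move=> s0 dW.
pose F t := W (t *: p + (s *: q + x)) - W (t *: p + x).
pose F' t := Wp (t *: p + (s *: q + x)) - Wp (t *: p + x).
have dF (t : R) : 0 <= t <= s -> is_derive t 1 F (F' t).
  move=> ts; apply: is_deriveB.
    have [||h _] := dW t s; rewrite ?s0 ?lexx//.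
    by apply: is_derive_line h => h; rewrite scaler1 scalerDl addrA.
  have [||h _] := dW t 0; rewrite ?s0 ?lexx//; rewrite scale0r add0r in h.
  by apply: is_derive_line h => h; rewrite scaler1 scalerDl addrA.
have [||a] := MVT_segment s0 (f := F) (df := F').
- by move=> t; rewrite in_itv/= => /andP[/ltW t0 /ltW ts]; apply: dF; rewrite t0.
- apply: derivable_within_continuous => t; rewrite in_itv/= => ts.
  by have [] := dF _ ts.
rewrite in_itv/= subr0 => as0 Fa.
pose G t := Wp (t *: q + (a *: p + x)).
pose G' t := Wpq (t *: q + (a *: p + x)).
have dG (t : R) : 0 <= t <= s -> is_derive t 1 G (G' t).
  move=> ts; have [||_ h] := dW a t => //.
  by apply: is_derive_line h => h; rewrite /G scaler1 scalerDl addrA.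
have [||b] := MVT_segment s0 (f := G) (df := G').
- by move=> t; rewrite in_itv/= => /andP[/ltW t0 /ltW ts]; apply: dG; rewrite t0.
- apply: derivable_within_continuous => t; rewrite in_itv/= => ts.
  by have [] := dG _ ts.
rewrite in_itv/= subr0 => bs0 Gb.
exists a, b; split => //; rewrite expr2 mulrA -[Wpq _ * s]Gb.
have -> : G s - G 0 = F' a by rewrite /G /F' scale0r add0r addrCA.
by rewrite -Fa /F scale0r !add0r; ring.
Qed.

Lemma second_difference (V : normedModType R) (W Wp Wpq : V -> R) (x p q : V) (e : R) :
  (\forall y \near x, is_derive y p W (Wp y)) ->
  (\forall y \near x, is_derive y q Wp (Wpq y)) ->
  {for x, continuous Wpq} -> 0 < e ->
  \forall s \near 0^'+,
    `|W (s *: p + (s *: q + x)) - W (s *: p + x) - (W (s *: q + x) - W x) - Wpq x * s ^+ 2|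
    <= e * s ^+ 2.
Proof.
move=> d1 d2 /cvgrPdist_le cW e0.
have /nbhs_ballP[r /= r0 hr] : \forall y \near x, [/\ is_derive y p W (Wp y),
   is_derive y q Wp (Wpq y) & `|Wpq x - Wpq y| <= e].
  by near=> y; split; near: y => //; exact: cW.
have M0 : 0 < `|p| + `|q| + 1 by rewrite ltr_wpDl// addr_ge0.
have inb a b s : 0 <= a <= s -> 0 <= b <= s -> s < r / (`|p| + `|q| + 1) ->
    ball x r (a *: p + (b *: q + x)).
  move=> /andP[a0 as_] /andP[b0 bs] sr; rewrite -ball_normE/= distrC addrA addrK.
  rewrite (le_lt_trans (ler_normD _ _))// !normrZ !ger0_norm//.
  rewrite (@le_lt_trans _ _ (s * (`|p| + `|q| + 1)))//; last by rewrite -ltr_pdivlMr.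
  rewrite !mulrDr mulr1 -[leLHS]addr0 lerD// ?(le_trans a0)//.
  by rewrite lerD// ler_wpM2r.
near=> s.
have s0 : 0 < s by near: s; exact: nbhs_right_gt.
have sr : s < r / (`|p| + `|q| + 1) by near: s; apply: nbhs_right_lt; rewrite divr_gt0.
have [|a [b [as_ bs ->]]] := @second_difference_mean_value V W Wp Wpq x p q s (ltW s0).
  move=> a b as_ bs; split.
    by have [] := hr _ (inb a b s as_ bs sr).
  by rewrite addrCA; have [] := hr _ (inb a b s as_ bs sr).
rewrite -mulrBl normrM [X in _ * X]ger0_norm ?sqr_ge0// ler_wpM2r ?sqr_ge0//.
by rewrite distrC addrCA; have [] := hr _ (inb a b s as_ bs sr).
Unshelve. all: by end_near. Qed.

(** The second difference is symmetric in [p] and [q], and divided by s^2 it tends to either mixed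
    derivative. *)
Lemma mixed_partials (V : normedModType R) (W Wp Wq Wpq Wqp : V -> R) (x p q : V) :
  (\forall y \near x, is_derive y p W (Wp y)) ->
  (\forall y \near x, is_derive y q W (Wq y)) ->
  (\forall y \near x, is_derive y q Wp (Wpq y)) ->
  (\forall y \near x, is_derive y p Wq (Wqp y)) ->
  {for x, continuous Wpq} -> {for x, continuous Wqp} -> Wpq x = Wqp x.
Proof.
move=> dp dq dpq dqp cpq cqp; apply/eqP; rewrite -subr_eq0 -normr_eq0.
rewrite eq_le normr_ge0 andbT; apply/ler_addgt0Pr => e e0; rewrite add0r.
have e2 : 0 < e / 2 by rewrite divr_gt0.
near (0 : R)^'+ => s.
have s0 : 0 < s ^+ 2 by rewrite exprn_gt0//; near: s; exact: nbhs_right_gt.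
rewrite -(ler_pM2r s0) -[X in _ * X <= _](ger0_norm (ltW s0)) -normrM.
have h1 : `|W (s *: p + (s *: q + x)) - W (s *: p + x) - (W (s *: q + x) - W x) - Wpq x * s ^+ 2|
    <= e / 2 * s ^+ 2 by near: s; exact: (second_difference dp dpq cpq e2).
have h2 : `|W (s *: q + (s *: p + x)) - W (s *: q + x) - (W (s *: p + x) - W x) - Wqp x * s ^+ 2|
    <= e / 2 * s ^+ 2 by near: s; exact: (second_difference dq dqp cqp e2).
rewrite addrCA in h2.
set A := W (s *: p + _) in h1 h2; set B := W (s *: p + x) in h1 h2.
set C := W (s *: q + x) in h1 h2.
have -> : (Wpq x - Wqp x) * s ^+ 2 = (A - C - (B - W x) - Wqp x * s ^+ 2)
   - (A - B - (C - W x) - Wpq x * s ^+ 2) by ring.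
by rewrite (le_trans (ler_normB _ _))//; lra.
Unshelve. all: by end_near. Qed.

End SecondDifference.

(** * Hessians of C^2 functions and their signs *)

Section C2Functions.
Variables (R : realType) (n : nat) (U : set 'rV[R]_n) (oU : open U).
Implicit Types (W : 'rV[R]_n -> R) (x w : 'rV[R]_n).

Lemma is_derive_partial W i x : differentiable W x ->
  is_derive x (delta_mx 0 i) W (partial W i x).
Proof. by move=> dW; apply: derivableP; exact: diff_derivable. Qed.

Lemma is_derive_dir W x w : differentiable W x ->
  is_derive x w W (\sum_i w 0 i * partial W i x).
Proof.
move=> dW; have h := @derivableP _ _ _ W x w (diff_derivable dW).
apply: (is_derive_congr h) => //; rewrite deriveE// {1}(row_sum_delta w) linear_sum.
apply: eq_bigr => i _; rewrite linearZ; congr (_ * _).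
by rewrite /partial deriveE.
Qed.

Lemma near_open x : U x -> \forall y \near x, U y.
Proof. by move=> Ux; exact: open_nbhs_nbhs. Qed.

Lemma hessian_sym W x : C2_on U W -> U x -> (hessian W x)^T = hessian W x.
Proof.
move=> [C1W C2W] Ux; apply/matrixP => i j; rewrite !mxE.
apply: (@mixed_partials _ _ W (partial W i) (partial W j)
   (partial (partial W i) j) (partial (partial W j) i) x (delta_mx 0 i) (delta_mx 0 j)).
- by apply: filterS (near_open Ux) => y Uy; apply: is_derive_partial; have [] := C1W y Uy.
- by apply: filterS (near_open Ux) => y Uy; apply: is_derive_partial; have [] := C1W y Uy.
- by apply: filterS (near_open Ux) => y Uy; apply: is_derive_partial; have [] := C2W i y Uy.
- by apply: filterS (near_open Ux) => y Uy; apply: is_derive_partial; have [] := C2W j y Uy.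
- by have [_] := C2W i x Ux; exact.
- by have [_] := C2W j x Ux; exact.
Qed.

Lemma second_difference_hessian W x w e : C2_on U W -> U x -> 0 < e ->
  \forall s \near 0^'+,
    `|W (s *: w + (s *: w + x)) - W (s *: w + x) - (W (s *: w + x) - W x)
       - qform (hessian W x) (fun i => w 0 i) * s ^+ 2| <= e * s ^+ 2.
Proof.
move=> [C1W C2W] Ux e0.
have qE y : qform (hessian W y) (fun i => w 0 i) =
   \sum_j w 0 j * \sum_i w 0 i * partial (partial W j) i y.
  rewrite /qform exchange_big/=; apply: eq_bigr => j _; rewrite mulr_sumr.
  by apply: eq_bigr => i _; rewrite mxE; ring.
apply: (@second_difference _ _ W (fun y => \sum_i w 0 i * partial W i y)
  (fun y => qform (hessian W y) (fun i => w 0 i))) => //.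
- by apply: filterS (near_open Ux) => y Uy; apply: is_derive_dir; have [] := C1W y Uy.
- apply: filterS (near_open Ux) => y Uy; rewrite qE.
  have h i := is_deriveZ (w 0 i) (is_derive_dir w (proj1 (C2W i y Uy))).
  apply: (is_derive_congr (is_derive_sum h)) => //.
  by move=> z; rewrite fct_sumE.
- rewrite (funext qE); apply: (@cvg_sum_seq _ _ (nbhs x)) => j; apply: cvgM; first exact: cvg_cst.
  apply: (@cvg_sum_seq _ _ (nbhs x)) => i; apply: cvgM; first exact: cvg_cst.
  by have [_] := C2W j x Ux; exact.
Qed.

(** The points x, x + s w, x + 2 s w are equally spaced, so this second difference over s^2 tends to
    the form at [w]; concavity controls it by its midpoint inequality. *)
Lemma hessian_le0 W x w : C2_on U W -> U x ->
  (\forall s \near 0^'+, W (s *: w + (s *: w + x)) - 2 * W (s *: w + x) + W x <= 0) ->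
  qform (hessian W x) (fun i => w 0 i) <= 0.
Proof.
move=> C2W Ux hW; apply/ler_addgt0Pr => e e0; rewrite add0r.
near (0 : R)^'+ => s.
have s0 : 0 < s ^+ 2 by rewrite exprn_gt0//; near: s; exact: nbhs_right_gt.
rewrite -(ler_pM2r s0).
have : `|W (s *: w + (s *: w + x)) - W (s *: w + x) - (W (s *: w + x) - W x)
       - qform (hessian W x) (fun i => w 0 i) * s ^+ 2| <= e * s ^+ 2.
  by near: s; exact: second_difference_hessian.
rewrite ler_norml => /andP[h _].
have : W (s *: w + (s *: w + x)) - 2 * W (s *: w + x) + W x <= 0 by near: s.
by lra.
Unshelve. all: by end_near. Qed.

Lemma hessian_ge0 W x w : C2_on U W -> U x ->
  (\forall s \near 0^'+, 0 <= W (s *: w + (s *: w + x)) - 2 * W (s *: w + x) + W x) ->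
  0 <= qform (hessian W x) (fun i => w 0 i).
Proof.
move=> C2W Ux hW; rewrite -oppr_le0; apply/ler_addgt0Pr => e e0; rewrite add0r.
near (0 : R)^'+ => s.
have s0 : 0 < s ^+ 2 by rewrite exprn_gt0//; near: s; exact: nbhs_right_gt.
rewrite -(ler_pM2r s0).
have : `|W (s *: w + (s *: w + x)) - W (s *: w + x) - (W (s *: w + x) - W x)
       - qform (hessian W x) (fun i => w 0 i) * s ^+ 2| <= e * s ^+ 2.
  by near: s; exact: second_difference_hessian.
rewrite ler_norml => /andP[_ h].
have : 0 <= W (s *: w + (s *: w + x)) - 2 * W (s *: w + x) + W x by near: s.
by lra.
Unshelve. all: by end_near. Qed.

Lemma midpoint_eq (w x : 'rV[R]_n) (s : R) :
  s *: w + x = (1 - 2^-1) *: (s *: w + (s *: w + x)) + 2^-1 *: x.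
Proof. by apply/rowP => i; rewrite !mxE; field. Qed.

Lemma near_line x w : U x -> \forall s \near (0 : R)^'+, U (s *: w + (s *: w + x)).
Proof.
move=> Ux; have c : continuous (fun s : R => s *: w + (s *: w + x)).
  move=> s; apply: cvgD; first by apply: cvgZr_tmp; exact: cvg_id.
  by apply: cvgD; [apply: cvgZr_tmp; exact: cvg_id|exact: cvg_cst].
apply: cvg_at_right_filter (c 0) _ _.
by apply: near_open; rewrite !scale0r !add0r.
Qed.

Lemma hessian_nsd W x (w : 'I_n -> R) : C2_on U W -> U x -> concave_on U W ->
  qform (hessian W x) w <= 0.
Proof.
move=> C2W Ux cW; have -> : w = (fun i => (\row_j w j) 0 i).
  by apply/funext => i; rewrite mxE.
apply: hessian_le0 => //; apply: filterS (near_line (\row_j w j) Ux) => s Us.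
have := cW _ _ 2^-1 Us Ux; rewrite -midpoint_eq.
have -> : 0 <= (2^-1 : R) <= 1 by apply/andP; split; lra.
move=> /(_ isT); lra.
Qed.

Lemma hessian_psd W x (w : 'I_n -> R) : C2_on U W -> U x -> convex_on U W ->
  0 <= qform (hessian W x) w.
Proof.
move=> C2W Ux cW; have -> : w = (fun i => (\row_j w j) 0 i).
  by apply/funext => i; rewrite mxE.
apply: hessian_ge0 => //; apply: filterS (near_line (\row_j w j) Ux) => s Us.
have := cW _ _ 2^-1 Us Ux; rewrite -midpoint_eq.
have -> : 0 <= (2^-1 : R) <= 1 by apply/andP; split; lra.
move=> /(_ isT); lra.
Qed.

End C2Functions.

Section CoordinateNorm.
Variables (R : realType) (n : nat).

Lemma coord_le_norm (x : 'rV[R]_n) i : `|x 0 i| <= `|x|.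
Proof.
rewrite [leRHS]/Num.norm/= mx_normrE; apply/bigmax_geP; right => /=.
by exists (0, i).
Qed.

End CoordinateNorm.

(** * Reduction of the theorem to a function U defined everywhere *)

Section Reduction.
Variables (R : realType) (n : nat) (Omega K : set 'rV[R]_n).
Variables (W g : 'rV[R]_n -> R) (kappa sg : R).
Hypotheses (oO : open Omega) (cK : compact K) (KO : K `<=` Omega).
Hypothesis C2W : C2_on Omega W.
Hypothesis W_gt0 : forall x, Omega x -> 0 < W x.
Hypothesis uH : forall x, Omega x -> hessian W x \in unitmx.
Hypothesis C1g : C1_on setT g.
Hypothesis gK : forall x, ~ K x -> g x = 0.
Hypothesis sg2 : sg * sg = 1.
Hypothesis sgk : 0 < sg * kappa.

Local Notation f := (fun x => g x * W x).
Local Notation Q x := ((grad f x *m invmx (hessian W x) *m (grad f x)^T) 0 0).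

Let closedK : closed K.
Proof. by apply: compact_closed => //; exact: norm_hausdorff. Qed.

Lemma near_notin_support x : ~ K x -> \forall y \near x, ~ K y.
Proof.
by move=> nK; apply: open_nbhs_nbhs; split => //; exact: closed_openC.
Qed.

Lemma local_product_zero x : ~ K x -> \forall y \near x, 0 = f y.
Proof. by move/near_notin_support; apply: filterS => y /gK ->; rewrite mul0r. Qed.

Lemma product_zero x : ~ K x -> f x = 0.
Proof. by move/gK ->; rewrite mul0r. Qed.

Lemma differentiable_product x : Omega x -> differentiable f x.
Proof.
move=> Ox; apply: differentiableM; first by have [] := C1g (I : setT x).
by have [] := proj1 C2W x Ox.
Qed.

Lemma partial_product i x : Omega x ->
  partial f i x = g x * partial W i x + W x * partial g i x.
Proof.
move=> Ox; rewrite /partial deriveM//; apply: diff_derivable.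
  by have [] := C1g (I : setT x).
by have [] := proj1 C2W x Ox.
Qed.

Lemma partial_product0 i x : ~ K x -> partial f i x = 0.
Proof.
move/local_product_zero => h; rewrite /partial -(near_eq_derive _ h).
exact: derive_cst.
Qed.

Lemma is_derive_product i x : is_derive x (delta_mx 0 i) f (partial f i x).
Proof.
have [Kx|nKx] := pselect (K x).
  by apply: is_derive_partial; exact/differentiable_product/KO.
rewrite partial_product0//; exact: near_eq_is_derive (local_product_zero nKx) _.
Qed.

(** Since [K] is closed, a point off [K] has a neighbourhood where h is identically 0, and every
    other point lies in the open set [Omega]. *)
Lemma continuous_off_support (h : 'rV[R]_n -> R) :
  (forall x, ~ K x -> h x = 0) -> (forall x, Omega x -> {for x, continuous h}) ->
  continuous h.
Proof.
move=> h0 hO x; have [Kx|nKx] := pselect (K x); first exact/hO/KO.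
suff : h y @[y --> x] --> h x by [].
rewrite h0//; apply: (@cvg_near_cst _ _ _ _ (nbhs x)).
by apply: filterS (near_notin_support nKx) => y /h0 ->.
Qed.

Lemma continuous_product : continuous f.
Proof.
apply: continuous_off_support => x; first exact: product_zero.
by move=> /differentiable_product; exact: differentiable_continuous.
Qed.

Lemma continuous_partial_product i : continuous (partial f i).
Proof.
apply: continuous_off_support => x; first exact: partial_product0.
move=> Ox; suff : partial f i y @[y --> x] --> partial f i x by [].
rewrite partial_product//.
have c : (g y * partial W i y + W y * partial g i y) @[y --> x] -->
    g x * partial W i x + W x * partial g i x.
  have [dg cg] := C1g (I : setT x); have [dW cW] := proj1 C2W x Ox.
  have g1 : g y @[y --> x] --> g x by exact: differentiable_continuous.
  have W1 : W y @[y --> x] --> W x by exact: differentiable_continuous.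
  have gi : partial g i y @[y --> x] --> partial g i x by exact: cg.
  have Wi : partial W i y @[y --> x] --> partial W i x by exact: cW.
  exact: (cvgD (cvgM g1 Wi) (cvgM W1 gi)).
apply: cvg_near_eq c.
by apply: filterS (near_open oO Ox) => y Oy; rewrite partial_product.
Qed.

(** The Legendre dual of the form of [sg] times the Hessian of W. The test on [Omega] discards the
    meaningless Hessian outside; as [e] vanishes off [K], no discontinuity appears at the
    boundary. *)
Let e x := if `[< Omega x >] then - sg * Q x else 0.

Lemma grad_product0 x : ~ K x -> grad f x = 0.
Proof. by move=> nK; apply/rowP => i; rewrite !mxE partial_product0. Qed.

Let e0 x : ~ K x -> e x = 0.
Proof.
by move=> /grad_product0 g0; rewrite /e g0 !mul0mx mxE mulr0; case: ifP.
Qed.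

Let ce : continuous e.
Proof.
apply: continuous_off_support => x; first exact: e0.
move=> Ox; pose S y := \sum_j (\sum_i partial f i y * invmx (hessian W y) i j) * partial f j y.
have QE y : Q y = S y.
  rewrite mxE; apply: eq_bigr => j _; rewrite !mxE; congr (_ * _).
  by apply: eq_bigr => i _; rewrite !mxE.
have cp i : partial f i y @[y --> x] --> partial f i x by exact: continuous_partial_product.
have cS : S y @[y --> x] --> S x.
  apply: (@cvg_sum_seq _ _ (nbhs x)) => j; apply: cvgM (cp j).
  apply: (@cvg_sum_seq _ _ (nbhs x)) => i; apply: cvgM (cp i) _.
  apply: (@cvg_invmx _ _ (nbhs x)); last exact: uH.
    move=> k l; have [_ /(_ k) h] := proj2 C2W l x Ox.
    have -> : (fun y => hessian W y k l) = partial (partial W l) k.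
      by apply/funext => y; rewrite mxE.
    by rewrite [hessian W x k l]mxE.
  by apply: filterS (near_open oO Ox) => y; exact: uH.
have c : - sg * S y @[y --> x] --> - sg * S x.
  exact: (cvgM (@cvg_cst _ (- sg) _ (nbhs x) _) cS).
suff : e y @[y --> x] --> e x by [].
rewrite {2}/e asboolT// QE; apply: cvg_near_eq c.
by apply: filterS (near_open oO Ox) => y Oy; rewrite /e asboolT// QE.
Qed.

(** Here [rho'] is the profile r of the measure and [drho] its derivative; the prime only separates
    it from the density [rho]. The sign [sg] is that of kappa, so U imitates [sg] times W to second
    order on [K]. *)
Variables (phi rho' drho : R -> R) (dom : set R).
Variables (a : nat -> R) (adm : nat -> R -> Prop).
Hypothesis dphi : forall s, dom s -> is_derive s 1 phi (rho' s).
Hypothesis dvrho : forall s, dom s -> is_derive s 1 rho' (drho s).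
Hypothesis cdrho : forall s, dom s -> {for s, continuous drho}.
Hypothesis rho_gt0 : forall s, dom s -> 0 < rho' s.
Hypothesis drho_gt0 : forall s, dom s -> 0 < drho s.
Hypothesis a0_phi : forall s, dom s -> a 0 * phi s <= rho' s ^+ 2 / drho s.
Hypothesis a_step : forall n m s u, dom u -> adm n.+1 m ->
  adm n (m + s) /\
  a n.+1 * m ^+ 2 * phi u <= (a n * (m + s) ^+ 2 - 2 * m * s) * phi u.
Hypothesis adm0 : adm n 0.

Variables (U : 'rV[R]_n -> R) (DU : 'I_n -> 'rV[R]_n -> R).
Variable D2U : 'I_n -> 'I_n -> 'rV[R]_n -> R.
Hypothesis domU : forall x, dom (U x).
Hypothesis cU : continuous U.
Hypothesis cDU : forall i, continuous (DU i).
Hypothesis cD2U : forall i j, continuous (D2U i j).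
Hypothesis dU : forall i x, is_derive x (delta_mx 0 i) U (DU i x).
Hypothesis dDU : forall i j x, is_derive x (delta_mx 0 i) (DU j) (D2U i j x).
Hypothesis symU : forall i j x, D2U i j x = D2U j i x.
Hypothesis nsdU : forall x w, qform (\matrix_(i, j) D2U i j x) w <= 0.
Hypothesis D2UK : forall x, K x -> \matrix_(i, j) D2U i j x = sg *: hessian W x.
Hypothesis rhoUK : forall x, K x -> rho' (U x) = W x `^ kappa^-1.
Hypothesis drhoUK : forall x, K x ->
  sg * kappa * drho (U x) = W x `^ kappa^-1 / W x.

(** On [K] this is [le_quad_nsd] for [sg] times the Hessian of W. Off [K] the gradient of f and [e]
    both vanish, and concavity of U suffices. *)
Let e_ge x (w : 'I_n -> R) : 2 * (\sum_i w i * partial f i x) +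
     \sum_i \sum_j w i * w j * D2U i j x <= e x.
Proof.
have -> : \sum_i \sum_j w i * w j * D2U i j x = qform (\matrix_(i, j) D2U i j x) w.
  by apply: eq_bigr => i _; apply: eq_bigr => j _; rewrite mxE.
have [Kx|nKx] := pselect (K x); last first.
  rewrite e0// big1 ?mulr0 ?add0r// => i _.
  by rewrite partial_product0// mulr0.
have Ox := KO Kx; have := nsdU x; rewrite (D2UK Kx) /e asboolT// => nsd.
have sg0 : sg != 0 by apply/eqP => z; move: sg2; rewrite z mulr0 => /esym/eqP; rewrite oner_eq0.
have sgV : sg^-1 = sg by rewrite -[RHS](mulfK sg0) sg2 mul1r.
have u' : sg *: hessian W x \in unitmx by rewrite unitmxZ ?unitfE//; exact: uH.
have s' : (sg *: hessian W x)^T = sg *: hessian W x.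
  by rewrite linearZ/=; congr (_ *: _); exact: (hessian_sym oO C2W Ox).
have := le_quad_nsd (grad f x) (\row_i w i) u' s' nsd.
rewrite invmxZ// sgV.
have -> : (grad f x *m (sg *: invmx (hessian W x)) *m (grad f x)^T) 0 0 = sg * Q x.
  by rewrite -scalemxAr -scalemxAl mxE.
rewrite mulNr.
have -> : (fun i => (\row_i0 w i0) 0 i) = w by apply/funext => i; rewrite mxE.
by under eq_bigr do rewrite !mxE.
Qed.

(** With c = [sg * kappa], on the support g rho is c f drho(U) and g^2 W rho is c f^2 drho(U). All
    integrands vanish off [K], so a box containing [K] sees everything. *)
Lemma brascamp_lieb_of_extension :
  iint (fun x => (g x * rho kappa W Omega x)%:E) = (0 : R)%:E ->
  (iint (fun x => (g x ^+ 2 * W x * rho kappa W Omega x)%:E)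
     <= (- kappa)%:E *
        iint (fun x => (if `[< Omega x >] then Q x * rho kappa W Omega x else 0)%:E))%E.
Proof.
have [L [L0 KL]] : exists L, 0 < L /\ K `<=` box L (k := n).
  have [M [_ hM]] := compact_bounded cK.
  exists (`|M| + 1); split; first by rewrite ltr_wpDl.
  move=> x Kx i; have : `|x| <= `|M| + 1.
    by apply: hM Kx; rewrite (le_lt_trans (ler_norm _))// ltrDl.
  exact/le_trans/coord_le_norm.
have L0' := ltW L0.
have crho : continuous (fun x => rho' (U x)).
  by apply: cont_comp_for => // x; apply: is_derive_continuous; exact: dvrho.
have cdr : continuous (fun x => drho (U x)).
  by apply: cont_comp_for => // x; exact: cdrho.
have cf := continuous_product.
have f0 x : ~ box L x -> f x = 0 by move=> nb; apply: product_zero => /KL.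
have e0L x : ~ box L x -> e x = 0 by move=> nb; apply: e0 => /KL.
pose c := sg * kappa; have c0 : c != 0 by rewrite gt_eqF.
have rhoK x : K x -> rho kappa W Omega x = W x `^ kappa^-1.
  by move=> Kx; rewrite /rho asboolT//; exact: KO.
have drhoE x : K x -> drho (U x) = c^-1 * (rho kappa W Omega x / W x).
  by move=> Kx; rewrite rhoK// -drhoUK// mulKf.
have W0 x : K x -> W x != 0 by move=> Kx; rewrite gt_eqF//; exact/W_gt0/KO.
have E1 x : g x * rho kappa W Omega x = c * (f x * drho (U x)).
  have [Kx|nKx] := pselect (K x); last by rewrite gK// !mul0r mulr0.
  by rewrite drhoE//; have := W0 _ Kx => ?; field; exact/andP.
have E2 x : g x ^+ 2 * W x * rho kappa W Omega x = c * (f x ^+ 2 * drho (U x)).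
  have [Kx|nKx] := pselect (K x); last by rewrite gK// !(mul0r, expr0n)/= mulr0.
  by rewrite drhoE//; have := W0 _ Kx => ?; field; exact/andP.
have E3 x : (if `[< Omega x >] then Q x * rho kappa W Omega x else 0)
    = - sg * (e x * rho' (U x)).
  have [Kx|nKx] := pselect (K x).
    by rewrite /e asboolT ?rhoK ?rhoUK//; [rewrite !mulNr mulrN opprK !mulrA sg2 mul1r|exact: KO..].
  by rewrite e0// grad_product0// !mul0mx mxE !mul0r mulr0; case: ifP.
under eq_fun do rewrite E1.
rewrite (@iint_ibox R L n (fun x => c * (f x * drho (U x)))) //; last 2 first.
- by apply: contM; [exact: contC|exact: contM].
- by move=> x /f0 ->; rewrite mul0r mulr0.
rewrite iboxZ//; last exact: contM.
move=> [/eqP]; rewrite mulf_eq0 (negbTE c0)/= => /eqP fd0.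
under eq_fun do rewrite E2; under [X in (_ <= _ * iint X)%E]eq_fun do rewrite E3.
rewrite (@iint_ibox R L n (fun x => c * (f x ^+ 2 * drho (U x)))) //; last 2 first.
- by apply: contM; [exact: contC|apply: contM => //; exact: contX].
- by move=> x /f0 ->; rewrite expr0n/= mul0r mulr0.
rewrite (@iint_ibox R L n (fun x => - sg * (e x * rho' (U x)))) //; last 2 first.
- by apply: contM; [exact: contC|exact: contM].
- by move=> x /e0L ->; rewrite mul0r mulr0.
rewrite !iboxZ//; [|exact: contM|by apply: contM => //; exact: contX].
rewrite -EFinM lee_fin mulrA mulrNN [kappa * _]mulrC ler_pM2l//.
apply: (box_brascamp_lieb L0 dphi dvrho cdrho rho_gt0 drho_gt0 a0_phi a_step
  domU cU cDU cD2U dU dDU symU cf _ is_derive_product ce e_ge adm0 fd0).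
exact: continuous_partial_product.
Qed.

End Reduction.

(** * For kappa < 0 the function W has no zero *)

Section Positivity.
Variable R : realType.
Local Notation mu := (@lebesgue_measure R).

(** The integral of a nonnegative function is a supremum over simple functions below it, so one step
    function gives the bound, with no appeal to measurability of [F]. *)
Lemma integral_ge_itv (F : R -> \bar R) (c p r : R) : 0 <= c -> 0 < r ->
  (forall t, 0 <= F t)%E ->
  (forall t, (`|p - t| < r)%R -> t != p -> c%:E <= F t)%E ->
  ((c * (r *+ 2))%:E <= \int[mu]_t F t)%E.
Proof.
move=> c0 r0 F0 Fc; pose A : set (measurableTypeR R) := ball p r `\ p.
have mA : measurable A by apply: measurableD; [rewrite ball_itv; exact: measurable_itv|exact: measurable_set1].
have muA : mu A = (r *+ 2)%:E.
  rewrite -(lebesgue_measure_ball p (ltW r0)) -[LHS]mul1e -integral_cst//.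
  rewrite integral_setD1//; rewrite integral_cst ?mul1e//.
  by rewrite ball_itv; exact: measurable_itv.
rewrite ge0_integralTE// EFinM -muA.
apply: ereal_sup_ubound; exists (scale_nnsfun (indic_nnsfun R mA) c0) => /=.
  move=> t; rewrite [X in (X%:E <= _)%E](_ : _ = c * \1_A t)// indicE.
  have [At|nAt] := boolP (t \in A); last by rewrite mulr0.
  rewrite mulr1; move/set_mem : At => [tp /eqP tnp].
  by apply: Fc => //; rewrite /ball/= in tp.
by rewrite sintegralrM sintegral_indic.
Qed.

Lemma iint_ge0 n (F : 'rV[R]_n -> \bar R) : (forall x, 0 <= F x)%E -> (0 <= iint F)%E.
Proof.
elim: n => [|n IH] in F *; move=> F0 //=.
by apply: integral_ge0 => t _; exact: IH.
Qed.

Lemma iint_ge_box n (F : 'rV[R]_n -> \bar R) (x0 : 'rV[R]_n) (c r : R) : 0 <= c -> 0 < r ->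
  (forall x, 0 <= F x)%E ->
  (forall x : 'rV[R]_n, (forall i, (`|x0 0 i - x 0 i| < r)%R) -> c%:E <= F x)%E ->
  ((c * (r *+ 2) ^+ n)%:E <= iint F)%E.
Proof.
elim: n => [|n IH] in F x0 *; move=> c0 r0 F0 Fc.
  by rewrite mulr1 /=; apply: Fc => -[].
rewrite exprSr mulrA; apply: (@integral_ge_itv _ _ (x0 0 0)) => //.
- by rewrite mulr_ge0// exprn_ge0// mulrn_wge0// ltW.
- by move=> t; apply: iint_ge0.
move=> t ht _; apply: (IH _ (\row_j x0 0 (lift 0 j))) => // v hv.
apply: Fc => i; rewrite -/(consV t v); case: (unliftP 0 i) => [j ->|->].
  by rewrite consV_lift; have := hv j; rewrite mxE.
by rewrite consV_head.
Qed.

(** Dropping the single value [x0 0 0] of the outermost variable already avoids [x0] and costs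
    nothing in measure. *)
Lemma iint_ge_punctured_box n (F : 'rV[R]_n.+1 -> \bar R) (x0 : 'rV[R]_n.+1) (c r : R) :
  0 <= c -> 0 < r -> (forall x, 0 <= F x)%E ->
  (forall x : 'rV[R]_n.+1, (forall i, (`|x0 0 i - x 0 i| < r)%R) -> x != x0 -> c%:E <= F x)%E ->
  ((c * (r *+ 2) ^+ n.+1)%:E <= iint F)%E.
Proof.
move=> c0 r0 F0 Fc.
rewrite exprSr mulrA; apply: (@integral_ge_itv _ _ (x0 0 0)) => //.
- by rewrite mulr_ge0// exprn_ge0// mulrn_wge0// ltW.
- by move=> t; apply: iint_ge0.
move=> t ht tx0; apply: (@iint_ge_box _ _ (\row_j x0 0 (lift 0 j))) => // v hv.
apply: Fc => [i|]; rewrite -/(consV t v).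
  case: (unliftP 0 i) => [j ->|->].
    by rewrite consV_lift; have := hv j; rewrite mxE.
  by rewrite consV_head.
by apply: contra tx0 => /eqP <-; rewrite consV_head.
Qed.

Lemma derive_at_min n (W : 'rV[R]_n -> R) (x0 v : 'rV[R]_n) :
  (forall x, differentiable W x) -> (forall x, W x0 <= W x) -> 'd W x0 v = 0.
Proof.
move=> dW hW; rewrite -deriveE//.
have h11 : (-1 : R) <= 1 by lra.
have d1 (t : R) : derivable (fun h : R => W (h *: v + x0)) t 1.
  have := diff_derivable (v := v) (dW (t *: v + x0)) => /derivableP.
  move=> /(@is_derive_line _ _ _ _ (fun h : R => W (h *: v + x0)) _ _ t 1).
  by case=> // h; rewrite scaler1 scalerDl addrA.
have h1 : is_derive (0 : R) 1 (fun h : R => W (h *: v + x0)) 0.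
  apply: (derive1_at_min h11) => //.
    by rewrite in_itv/=; apply/andP; split; lra.
  by move=> t _; rewrite scale0r add0r; exact: hW.
have h2 : is_derive x0 v W 0.
  by apply: is_derive_line h1 => h; rewrite addr0 scaler1.
by case: h2.
Qed.

(** The differential vanishes at a minimum, so W is o(|x - x0|) there, in particular at most |x -
    x0|. *)
Lemma near_le_norm n (W : 'rV[R]_n -> R) (x0 : 'rV[R]_n) :
  (forall x, differentiable W x) -> (forall x, W x0 <= W x) -> W x0 = 0 ->
  \forall x \near x0, W x <= `|x0 - x|.
Proof.
move=> dW hW W0; have := diff_locallyx (dW x0).
set k := 'o _ => kE.
have kE' h : k h = W (h + x0).
  by have := kE h; rewrite W0 derive_at_min// !add0r.
have /(littleoP [littleo of k]) /nbhs_ballP[r /= r0 hr] : 0 < (1 : R) by [].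
apply/nbhs_ballP; exists r => // x xr.
have b : ball 0 r (x - x0).
  by move: xr; rewrite -!ball_normE/= add0r normrN distrC.
have := hr _ b; rewrite kE' subrK mul1r distrC.
exact/le_trans/ler_norm.
Qed.

(** Between two zeros W vanishes on the whole segment, so the Hessian at [x0] degenerates along
    [x1 - x0], which invertibility forbids. *)
Lemma convex_zero_unique n (W : 'rV[R]_n -> R) (x0 x1 : 'rV[R]_n) :
  C2_on setT W -> (forall x, hessian W x \in unitmx) -> convex_on setT W ->
  (forall x, 0 <= W x) -> W x0 = 0 -> W x1 = 0 -> x1 = x0.
Proof.
move=> C2W uW cW W0 Wx0 Wx1; apply/eqP; rewrite -subr_eq0; apply/eqP.
have oT : open [set: 'rV[R]_n] by exact: openT.
apply: (psd_unit_definite (uW x0)); first exact: (hessian_sym oT C2W).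
  by move=> z; exact: (hessian_psd oT z C2W).
apply/eqP; rewrite eq_le (hessian_psd oT _ C2W)// andbT.
apply: (hessian_le0 oT) => //; near=> s.
have s0 : 0 <= s by apply: ltW; near: s; exact: nbhs_right_gt.
have s1 : s <= 2^-1 by near: s; apply: nbhs_right_le; rewrite invr_gt0.
have zero (t : R) : 0 <= t <= 1 -> W (t *: (x1 - x0) + x0) = 0.
  move=> t01; apply/eqP; rewrite eq_le W0 andbT.
  have := cW x0 x1 t I I t01; rewrite Wx0 Wx1 !mulr0 addr0.
  have -> // : t *: (x1 - x0) + x0 = (1 - t) *: x0 + t *: x1.
  by apply/rowP => i; rewrite !mxE; ring.
rewrite zero; last by apply/andP; split; lra.
rewrite addrA -scalerDl zero ?Wx0; last by apply/andP; split; lra.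
by rewrite mulr0 subr0 addr0.
Unshelve. all: by end_near. Qed.

(** Near a zero W(x) <= |x - x0|, so with b = -1/kappa >= n the density is at least s^(-b) on a box
    of half-side s <= 1, of mass at least 2^n s^(n-b) >= 2^n > 1. This contradicts total mass 1. *)
Lemma convex_density_gt0 n (W : 'rV[R]_n -> R) (kappa : R) : (0 < n)%N ->
  - (n%:R)^-1 <= kappa -> kappa < 0 ->
  C2_on setT W -> (forall x, hessian W x \in unitmx) -> convex_on setT W ->
  (forall x, 0 <= W x) -> iint (fun x => (rho kappa W setT x)%:E) = 1%E ->
  forall x, 0 < W x.
Proof.
case: n W => [//|n] W _ kn k0 C2W uW cW W0 int1 x0.
rewrite lt_neqAle W0 andbT eq_sym; apply/eqP => Wx0.
have dW x : differentiable W x by have [] := proj1 C2W x I.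
have [|r /= r0 hr] := (@nbhs_ballP R _ x0 _).1 (near_le_norm dW _ Wx0).
  by rewrite Wx0.
pose s := Num.min r 1.
have s0 : 0 < s by rewrite lt_min r0 ltr01.
have s1 : s <= 1 by rewrite ge_min lexx orbT.
have [b bE] : exists b, b = - kappa^-1 by eexists.
have bn : n.+1%:R <= b.
  rewrite bE -invrN -[leLHS]invrK lef_pV2 ?posrE ?invr_gt0 ?oppr_gt0//.
  by rewrite lerNl.
have := @iint_ge_punctured_box n (fun x => (rho kappa W setT x)%:E) x0 (s `^ (- b)) s.
rewrite int1 => /(_ (powR_ge0 _ _) s0); rewrite lee_fin => h.
have : s `^ (- b) * (s *+ 2) ^+ n.+1 <= 1.
  apply: h => x; first by rewrite lee_fin /rho; case: ifP => // _; exact: powR_ge0.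
  move=> hx xx0; rewrite lee_fin /rho asboolT//.
  (* A zero of W must be excluded here because [powR] gives 0 for 0 to a negative power; this is why
     the box is punctured and zeros are unique. *)
  have Wx : 0 < W x.
    rewrite lt_neqAle W0 andbT eq_sym; apply/eqP => Wx.
    by move/eqP: xx0; apply; exact: (convex_zero_unique C2W uW cW W0 Wx0 Wx).
  have nx : `|x0 - x| < s.
    rewrite [ltLHS]/Num.norm/= mx_normrE; apply/bigmax_ltP; split => // -[i j] _ /=.
    by rewrite ord1 !mxE.
  have Wxs : W x <= s.
    apply: le_trans (ltW nx); apply: hr; rewrite -ball_normE/=.
    by apply: lt_le_trans nx _; rewrite ge_min lexx.
  have kb : kappa^-1 = - b by rewrite bE opprK.
  rewrite kb !powRN lef_pV2 ?posrE ?powR_gt0//.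
  have b0 : 0 <= b by rewrite (le_trans _ bn).
  have := @ge0_ler_powR R b b0 (W x) s; rewrite !nnegrE W0 (ltW s0).
  by apply.
rewrite -[s *+ 2]mulr_natr exprMn mulrA leNgt => /negP; apply.
apply: (@lt_le_trans _ _ (1 * 2 ^+ n.+1)).
  by rewrite mul1r exprn_egt1// ltr1n.
rewrite ler_wpM2r ?exprn_ge0// -powR_mulrn ?(ltW s0)// -powRD; last first.
  by rewrite (gt_eqF s0) implybT.
by rewrite -[leLHS](powRr0 s) ger_powR ?s0//; lra.
Qed.

End Positivity.

(** * The case kappa < 0 *)

Section NegativeExponent.
Variable R : realType.

Lemma is_derive_powR_opp (c s : R) : s < 0 ->
  is_derive s 1 (fun s => (- s) `^ c) (- (c * (- s) `^ (c - 1))).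
Proof.
move=> s0; have s0' : 0 < - s by rewrite oppr_gt0.
have dN : is_derive s 1 (fun s : R => - s) (- 1) by exact: is_deriveNid.
apply: (is_derive_congr (is_derive_chain dN (is_derive1_powR c s0'))) => //.
by rewrite mulrN1.
Qed.

Lemma powR_sub1 (x c : R) : 0 < x -> x `^ (c - 1) = x `^ c / x.
Proof. by move=> x0; rewrite powRB ?(gt_eqF x0) ?implybT// powRr1// ltW. Qed.

(* The logarithm is needed only for n = 1, kappa = -1. *)
Let phi (b s : R) := if b == 1 then - ln (- s) else (b - 1)^-1 * (- s) `^ (1 - b).

Let dphi (b s : R) : s < 0 -> is_derive s 1 (phi b) ((- s) `^ (- b)).
Proof.
move=> s0; have s0' : 0 < - s by rewrite oppr_gt0.
rewrite /phi; case: eqP => [->|/eqP b1].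
  have dN : is_derive s 1 (fun s : R => - s) (- 1) by exact: is_deriveNid.
  apply: (is_derive_congr (is_deriveN (is_derive_chain dN (is_derive1_ln s0')))) => //.
  by rewrite powR_inv1 ?(ltW s0')// mulrN1 opprK.
apply: (is_derive_congr (is_deriveZ _ (is_derive_powR_opp (1 - b) s0))) => //.
rewrite /GRing.scale/= -mulNr opprB mulKf ?subr_eq0//.
by congr (_ `^ _); ring.
Qed.

Lemma convex_case (n : nat) (kappa : R) (W : 'rV[R]_n -> R) (g : 'rV[R]_n -> R) :
  (0 < n)%N -> (forall x, 0 <= W x) ->
  - (n%:R)^-1 <= kappa -> kappa < 0 -> convex_on setT W ->
  iint (fun x => (rho kappa W setT x)%:E) = 1%E ->
  C2_on setT W -> (forall x, hessian W x \in unitmx) ->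
  C1_on setT g -> compactly_supported_in setT g ->
  iint (fun x => (g x * rho kappa W setT x)%:E) = (0 : R)%:E ->
  (iint (fun x => (g x ^+ 2 * W x * rho kappa W setT x)%:E)
   <= (- kappa)%:E *
      iint (fun x => (if `[< setT x >] then
                        (grad (fun x => g x * W x) x *m invmx (hessian W x)
                         *m (grad (fun x => g x * W x) x)^T) 0 0
                        * rho kappa W setT x
                      else 0)%:E))%E.
Proof.
move=> n0 W0 kn k0 cW int1 C2W uW C1g [K [cK _ gK]] intg.
have Wp := convex_density_gt0 n0 kn k0 C2W uW cW W0 int1.
have oT : open [set: 'rV[R]_n] by exact: openT.
have [b bE] : exists b, b = - kappa^-1 by eexists.
have kb : kappa^-1 = - b by rewrite bE opprK.
have kV : kappa = - b^-1 by rewrite bE invrN opprK invrK.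
have bn : n%:R <= b.
  rewrite bE -invrN -[leLHS]invrK lef_pV2 ?posrE ?invr_gt0 ?oppr_gt0 ?ltr0n//.
  by rewrite lerNl.
have b1 : 1 <= b by rewrite (le_trans _ bn)// ler1n.
have b0 : 0 < b by rewrite (lt_le_trans _ b1).
have dW x : differentiable W x by have [] := proj1 C2W x I.
have dpW i x : differentiable (partial W i) x by have [] := proj2 C2W i x I.
apply: (@brascamp_lieb_of_extension R n setT K W g kappa (-1) oT cK _ C2W _ _ C1g gK _ _
  (phi b) (fun s => (- s) `^ (- b)) (fun s => b * (- s) `^ (- b - 1)) [set s | s < 0]
  (fun k => (b - k%:R - 1) / (b - k%:R))
  (fun k m => k%:R < b \/ (k%:R <= b /\ m = 0)) _ _ _ _ _ _ _ _
  (fun x => - W x) (fun i x => - partial W i x) (fun i j x => - hessian W x i j)) => //.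
- by rewrite mulrNN mulr1.
- by rewrite mulN1r oppr_gt0.
- by move=> s; exact: dphi.
- move=> s s0; apply: (is_derive_congr (is_derive_powR_opp (- b) s0)) => //.
  by rewrite mulNr opprK.
- move=> s s0.
  have [] := is_deriveZ b (is_derive_powR_opp (- b - 1) s0) => /derivable1_diffP + _.
  exact: differentiable_continuous.
- by move=> s /= s0; rewrite powR_gt0// oppr_gt0.
- by move=> s /= s0; rewrite mulr_gt0// powR_gt0// oppr_gt0.
(* For b > 1 both sides are equal, so (b - 1) / b is the largest possible [a 0]; for b = 1 it is
   0. *)
- move=> s /= s0; have s0' : 0 < - s by rewrite oppr_gt0.
  rewrite subr0 powR_sub1// /phi; case: eqP => [b1'|/eqP b1'].
    rewrite b1' subrr !mul0r divr_ge0 ?exprn_ge0 ?powR_ge0// mulr_ge0//.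
    by rewrite divr_ge0 ?powR_ge0// ltW.
  rewrite powRB ?(gt_eqF s0') ?implybT// powRr1 ?(ltW s0')// powRN.
  have p0 := powR_gt0 b s0'.
  move: ((- s) `^ b) p0 => p p0.
  have pn0 : p != 0 by rewrite gt_eqF.
  have bn0 : b != 0 by rewrite gt_eqF.
  have sn0 : s != 0 by rewrite lt_eqF.
  have b1n : b - 1 != 0 by rewrite subr_eq0.
  have -> : (b - 1) / b * ((b - 1)^-1 * (- s / p)) = - s / (b * p).
    by field; rewrite ?pn0 ?bn0 ?b1n.
  have -> // : p^-1 ^+ 2 / (b * (p^-1 / - s)) = - s / (b * p).
  by field; rewrite ?pn0 ?bn0 ?sn0.
- move=> k m s u /= u0 admk.
  have kb' : k.+1%:R <= b by case: admk => [/ltW|[]].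
  rewrite -natr1 in kb' admk *.
  have x1 : 0 < b - k%:R by lra.
  split; first by left; lra.
  have -> : b - (k%:R + 1) = b - k%:R - 1 by ring.
  (* The coefficient inequality may be multiplied by [phi b u] when this is nonnegative. Only the
     logarithm can be negative, and then b = 1, k = 0, m = 0 make both sides vanish. *)
  have : 0 <= ((b - k%:R - 1) / (b - k%:R) * (m + s) ^+ 2 - 2 * m * s
     - (b - k%:R - 1 - 1) / (b - k%:R - 1) * m ^+ 2) /\
     (0 <= phi b u \/ (b = 1 /\ k = 0%N /\ m = 0)).
    split; last first.
      rewrite /phi; case: eqP => [b1'|/eqP b1'].
        right; case: admk => [|[kb2 ->]]; first by rewrite b1'; have := ler0n R k; lra.
        split => //; split => //; apply/eqP; rewrite -leqn0 -(ler_nat R).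
        by rewrite b1' in kb2; lra.
      by left; rewrite mulr_ge0 ?powR_ge0// invr_ge0 subr_ge0.
    case: admk => [k1|[_ ->]]; last first.
      rewrite add0r expr0n/= !(mulr0, mul0r) !subr0 mulr_ge0 ?sqr_ge0//.
      by rewrite divr_ge0//; lra.
    have x2 : 0 < b - k%:R - 1 by lra.
    (* The gap is a perfect square, zero at the minimizer s = m / (b - k - 1). *)
    have -> : (b - k%:R - 1) / (b - k%:R) * (m + s) ^+ 2 - 2 * m * s
     - (b - k%:R - 1 - 1) / (b - k%:R - 1) * m ^+ 2 =
     ((b - k%:R - 1) * s - m) ^+ 2 / ((b - k%:R) * (b - k%:R - 1)).
      by field; rewrite !gt_eqF.
    by rewrite divr_ge0 ?sqr_ge0// mulr_ge0// ltW.
  case=> h [ph|[-> [-> ->]]]; last first.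
    by rewrite subr0 subrr !(mulr0, mul0r, expr0n)/= !(mul0r, subr0).
  by rewrite -subr_ge0 -mulrBl mulr_ge0.
- by case: (ltP n%:R b) => [|h]; [left|right].
- by move=> x /=; rewrite oppr_lt0.
- by apply: contN => x; exact: differentiable_continuous.
- by move=> i; apply: contN => x; exact: differentiable_continuous.
- move=> i j; apply: contN => x.
  rewrite (_ : (fun x => _) = partial (partial W j) i); last by apply/funext => y; rewrite mxE.
  by have [_] := proj2 C2W j x I; exact.
- by move=> i x; apply: is_deriveN; exact: is_derive_partial.
- by move=> i j x; rewrite mxE; apply: is_deriveN; exact: is_derive_partial.
- by move=> i j x; rewrite -[in LHS](hessian_sym oT C2W I) mxE.
- move=> x w; have -> : \matrix_(i, j) - hessian W x i j = - hessian W x.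
    by apply/matrixP => i j; rewrite !mxE.
  rewrite /qform -oppr_ge0 (_ : - _ = qform (hessian W x) w); first exact: (hessian_psd oT w C2W).
  rewrite -sumrN; apply: eq_bigr => i _; rewrite -sumrN; apply: eq_bigr => j _.
  by rewrite [(- hessian W x) i j]mxE mulrN opprK.
- by move=> x _; apply/matrixP => i j; rewrite !mxE mulN1r.
- by move=> x _; rewrite opprK kb.
- move=> x _; rewrite opprK kb kV powR_sub1//.
  by field; rewrite !gt_eqF.
Qed.

End NegativeExponent.

(** * Piecewise functions and a C^2 cutoff *)

Section Gluing.
Variable R : realType.

(** At the junction both pieces have difference quotients with the same limit, and each increment
    uses one of the two. *)
Lemma is_derive_glue (f1 f2 : R -> R) (s0 s d1 d2 : R) :
  f1 s0 = f2 s0 ->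
  (s0 <= s -> is_derive s 1 f1 d1) -> (s <= s0 -> is_derive s 1 f2 d2) ->
  (s = s0 -> d1 = d2) ->
  is_derive s 1 (fun s => if s0 <= s then f1 s else f2 s) (if s0 <= s then d1 else d2).
Proof.
move=> f12 h1 h2 d12; have [s0s|ss0|ss0] := ltgtP s0 s.
- apply: near_eq_is_derive (h1 (ltW s0s)).
  near=> t; rewrite ifT//; near: t.
  by apply: filterS (lt_nbhsr s0s) => t /ltW.
- apply: near_eq_is_derive (h2 (ltW ss0)).
  near=> t; rewrite ifF//; apply/negbTE; rewrite -ltNge; near: t.
  exact: lt_nbhsl.
subst s0; rewrite -d12// in h2.
have key (f : R -> R) d : is_derive s 1 f d ->
    h^-1 *: (f (h *: 1 + s) - f s) @[h --> 0^'] --> d.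
  by move=> [df <-].
have /cvgrPdist_le c1 := key _ _ (h1 (lexx _)).
have /cvgrPdist_le c2 := key _ _ (h2 (lexx _)).
apply: is_derive_cvg; apply/cvgrPdist_le => e e0.
apply: filterS2 (c1 e e0) (c2 e e0) => h.
rewrite scaler1 lexx; case: ifP => _ // _.
by rewrite f12.
Unshelve. all: by end_near. Qed.

Lemma continuous_maxr (s0 : R) : continuous (fun s => Num.max s s0).
Proof.
move=> s; apply: (@continuous_max R R id (fun=> s0)); first exact: cvg_id.
exact: cvg_cst.
Qed.

Lemma is_derive_pos (k : nat) (s : R) :
  is_derive s 1 (fun s => Num.max s 0 ^+ k.+2) (k.+2%:R * Num.max s 0 ^+ k.+1).
Proof.
have e j (t : R) : Num.max t 0 ^+ j.+1 = if 0 <= t then t ^+ j.+1 else 0.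
  by case: (leP 0 t) => t0; rewrite ?expr0n.
have h0 : (0 : R) ^+ k.+2 = 0 by rewrite expr0n.
have h1 : 0 <= s -> is_derive s 1 (fun s : R => s ^+ k.+2) (k.+2%:R * s ^+ k.+1).
  by move=> _; split; [exact: exprn_derivable|rewrite -derive1E exp_derive1].
have h2 : s <= 0 -> is_derive s 1 (fun _ : R => 0 : R) 0.
  by move=> _; exact: is_derive_cst.
have h3 : s = 0 -> k.+2%:R * s ^+ k.+1 = 0 by move=> ->; rewrite expr0n mulr0.
have := @is_derive_glue (fun s => s ^+ k.+2) (fun=> 0) 0 s _ _ h0 h1 h2 h3.
move/is_derive_congr; apply; first by move=> t; rewrite e.
by rewrite e; case: ifP => _; rewrite ?mulr0.
Qed.

Lemma cutoff (eta1 eta2 : R) : eta1 < eta2 ->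
  exists th th1 th2 : R -> R, [/\
    (forall s : R, is_derive s 1 th (th1 s)), (forall s : R, is_derive s 1 th1 (th2 s)),
    continuous th2, (forall s, 0 <= th s) &
    (forall s, s <= eta1 -> [/\ th s = 1, th1 s = 0 & th2 s = 0]) /\
    (forall s, eta2 <= s -> [/\ th s = 0, th1 s = 0 & th2 s = 0])].
Proof.
move=> e12; have e0 : 0 < eta2 - eta1 by rewrite subr_gt0.
pose p (s : R) := Num.max s 0.
have p0 s : s <= 0 -> p s = 0 by move=> s0; rewrite /p max_r.
have pge0 s : 0 <= p s by rewrite /p le_max lexx orbT.
pose c := (eta2 - eta1) ^+ 3.
have c0 : 0 < c by rewrite exprn_gt0.
(* The cube of a positive part is C^2. Two of them are nested: [v] is at most 0 up to [eta1] and
   equals 1 from [eta2] on, so 1 - max(v, 0)^3 is flat on both sides. *)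
pose v (s : R) := 1 - p (eta2 - s) ^+ 3 / c.
pose v1 (s : R) := 3 * p (eta2 - s) ^+ 2 / c.
pose v2 (s : R) := - (6 * p (eta2 - s) / c).
have da (s : R) : is_derive s 1 (fun s : R => eta2 - s) (-1).
  by apply: (is_derive_congr (is_deriveB (is_derive_cst eta2 s 1) (is_derive_id s 1))) => //; rewrite sub0r.
have dv (s : R) : is_derive s 1 v (v1 s).
  have h := is_derive_chain (da s) (is_derive_pos 1 (eta2 - s)).
  apply: (is_derive_congr (is_deriveB (is_derive_cst (1 : R) s 1) (is_deriveZ c^-1 h))).
    by move=> t; rewrite /v /= /GRing.scale/= [_ * c^-1]mulrC.
  by rewrite /v1 /p /GRing.scale/=; ring.
have dv1 (s : R) : is_derive s 1 v1 (v2 s).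
  have h := is_derive_chain (da s) (is_derive_pos 0 (eta2 - s)).
  apply: (is_derive_congr (is_deriveZ (3 / c) h)).
    by move=> t; rewrite /v1 /= /GRing.scale/=; rewrite /p; ring.
  by rewrite /v2 /p /GRing.scale/= expr1; ring.
exists (fun s => 1 - p (v s) ^+ 3), (fun s => - (3 * p (v s) ^+ 2 * v1 s)),
  (fun s => - (6 * p (v s) * v1 s * v1 s + 3 * p (v s) ^+ 2 * v2 s)).
have ca : continuous (fun s : R => eta2 - s) by move=> s; apply: cvgB; [exact: cvg_cst|exact: cvg_id].
have cp : continuous p by exact: continuous_maxr.
have cpa : continuous (fun s => p (eta2 - s)) by exact: cont_comp.
have cv1 : continuous v1.
  by apply: contM; [apply: contM; [exact: contC|exact: contX]|exact: contC].
have cv2 : continuous v2.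
  by apply: contN; apply: contM; [apply: contM; [exact: contC|]|exact: contC].
have cv : continuous v.
  by apply: contB; [exact: contC|apply: contM; [exact: contX|exact: contC]].
have cpv : continuous (fun s => p (v s)) by exact: cont_comp.
split.
- move=> s; have h := is_derive_chain (dv s) (is_derive_pos 1 (v s)).
  by apply: (is_derive_congr (is_deriveB (is_derive_cst (1 : R) s 1) h)) => //; rewrite sub0r.
- move=> s; have h := is_derive_chain (dv s) (is_derive_pos 0 (v s)).
  have h' : is_derive s 1 (fun s => 3 * p (v s) ^+ 2) (6 * p (v s) * v1 s).
    apply: (is_derive_congr (is_deriveZ 3 h)) => //.
    by rewrite /GRing.scale/= /p expr1; ring.
  apply: (is_derive_congr (is_deriveN (is_deriveM h' (dv1 s)))) => //.
  by rewrite /GRing.scale/=; ring.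
- exact: (contN (contD (contM (contM (contM (@contC _ _ _) cpv) cv1) cv1)
    (contM (contM (@contC _ _ _) (contX cpv)) cv2))).
- move=> s; rewrite subr_ge0 exprn_ile1//.
  rewrite /p ge_max ler01 andbT /v gerBl divr_ge0 ?exprn_ge0//; exact: ltW.
split => s hs.
  have pv : p (v s) = 0.
    apply: p0; rewrite /v subr_le0 ler_pdivlMr// mul1r /c lerXn2r// ?nnegrE ?(ltW e0)//.
    by rewrite /p le_max lerB.
  by rewrite pv !(expr0n, mulr0, mul0r)/= addr0 subr0 oppr0.
have pv : p (eta2 - s) = 0 by apply: p0; rewrite subr_le0.
rewrite /v /v1 /v2 pv !(expr0n, mulr0, mul0r)/= subr0 oppr0 mulr0 addr0.
by rewrite /p max_l// expr1n subrr oppr0.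
Qed.

End Gluing.

(** * Calculus of globally C^2 functions *)

Section C2Bundle.
Variables (R : realType) (n : nat).
Implicit Types (F : 'rV[R]_n -> R) (DF : 'I_n -> 'rV[R]_n -> R).

(** The derivatives are carried as explicit functions, the form in which [box_inequality] takes U,
    so Hessians of composites can be computed by algebra. *)
Record C2fun F DF (D2F : 'I_n -> 'I_n -> 'rV[R]_n -> R) : Prop := {
  C2_cont : continuous F;
  C2_cont1 : forall i, continuous (DF i);
  C2_cont2 : forall i j, continuous (D2F i j);
  C2_deriv : forall i x, is_derive x (delta_mx 0 i) F (DF i x);
  C2_deriv2 : forall i j x, is_derive x (delta_mx 0 i) (DF j) (D2F i j x);
  C2_sym : forall i j x, D2F i j x = D2F j i x }.

Lemma C2fun_comp (phi phi1 phi2 : R -> R) F DF D2F :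
  (forall s : R, is_derive s 1 phi (phi1 s)) -> (forall s : R, is_derive s 1 phi1 (phi2 s)) ->
  continuous phi2 -> C2fun F DF D2F ->
  C2fun (fun x => phi (F x)) (fun i x => phi1 (F x) * DF i x)
    (fun i j x => phi2 (F x) * DF i x * DF j x + phi1 (F x) * D2F i j x).
Proof.
move=> d1 d2 c2 [cF cF1 cF2 dF dF1 sF].
have c0 : continuous phi by move=> s; apply: is_derive_continuous; exact: d1.
have c1 : continuous phi1 by move=> s; apply: is_derive_continuous; exact: d2.
have cc1 : continuous (fun x => phi1 (F x)) by exact: cont_comp.
have cc2 : continuous (fun x => phi2 (F x)) by exact: cont_comp.
split.
- exact: cont_comp.
- by move=> i; exact: contM.
- by move=> i j; apply: contD; apply: contM => //; exact: contM.
- by move=> i x; exact: is_derive_chain.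
- move=> i j x; have h := is_derive_chain (dF i x) (d2 (F x)).
  apply: (is_derive_congr (is_deriveM h (dF1 i j x))) => //.
  by rewrite /GRing.scale/=; ring.
- by move=> i j x; rewrite sF; ring.
Qed.

Lemma C2fun_add F DF D2F G DG D2G a : C2fun F DF D2F -> C2fun G DG D2G ->
  C2fun (fun x => F x + a * G x) (fun i x => DF i x + a * DG i x)
    (fun i j x => D2F i j x + a * D2G i j x).
Proof.
move=> [cF cF1 cF2 dF dF1 sF] [cG cG1 cG2 dG dG1 sG].
split.
- by apply: contD => //; apply: contM => //; exact: contC.
- by move=> i; apply: contD => //; apply: contM => //; exact: contC.
- by move=> i j; apply: contD => //; apply: contM => //; exact: contC.
- by move=> i x; apply: (is_derive_congr (is_deriveD (dF i x) (is_deriveZ a (dG i x)))).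
- by move=> i j x; apply: (is_derive_congr (is_deriveD (dF1 i j x) (is_deriveZ a (dG1 i j x)))).
- by move=> i j x; rewrite sF sG.
Qed.

Lemma C2fun_cst (c : R) : C2fun (fun=> c) (fun _ _ => 0) (fun _ _ _ => 0).
Proof. by split => *; try exact: contC; try exact: is_derive_cst. Qed.

Lemma C2fun_sum (I : Type) (r : seq I) (F : I -> 'rV[R]_n -> R)
    (DF : I -> 'I_n -> 'rV[R]_n -> R) (D2F : I -> 'I_n -> 'I_n -> 'rV[R]_n -> R) :
  (forall k, C2fun (F k) (DF k) (D2F k)) ->
  C2fun (fun x => \sum_(k <- r) F k x) (fun i x => \sum_(k <- r) DF k i x)
    (fun i j x => \sum_(k <- r) D2F k i j x).
Proof.
move=> C2F; elim: r => [|k r IH].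
  have := C2fun_cst 0.
  by congr (C2fun _ _ _); do ?[apply/funext => ?]; rewrite big_nil.
have := C2fun_add 1 (C2F k) IH.
by congr (C2fun _ _ _); do ?[apply/funext => ?]; rewrite big_cons mul1r.
Qed.

Lemma C2fun_quadratic (l : 'rV[R]_n) (c : R) :
  C2fun (fun x => \sum_i x 0 i ^+ 2 + \sum_i l 0 i * x 0 i + c)
    (fun i x => 2 * x 0 i + l 0 i) (fun i j x => 2 * (i == j)%:R).
Proof.
have cx i : continuous (fun x : 'rV[R]_n => x 0 i) by exact: coord_continuous.
have dx i j x : is_derive x (delta_mx 0 i) (fun x : 'rV[R]_n => x 0 j) ((i == j)%:R).
  pose c1 : R := (i == j)%:R.
  have h : is_derive (0 : R) 1 (fun h : R => c1 * h + x 0 j) c1.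
    apply: (is_derive_congr (is_deriveD (is_deriveZ c1 (is_derive_id (0 : R) 1))
      (is_derive_cst (x 0 j) (0 : R) 1))) => //.
    by rewrite addr0 /GRing.scale/= mulr1.
  apply: is_derive_line h => h.
  by rewrite !mxE eqxx/= addr0 scaler1 /c1 [j == i]eq_sym mulrC.
split.
- apply: contD; last exact: contC.
  by apply: contD; apply: cont_sum => i; [exact: contX|apply: contM => //; exact: contC].
- by move=> i; apply: contD; [apply: contM => //; exact: contC|exact: contC].
- by move=> i j; exact: contC.
- move=> i x.
  have h1 k : is_derive x (delta_mx 0 i) (fun x : 'rV[R]_n => x 0 k ^+ 2 + l 0 k * x 0 k)
     ((2 * x 0 k + l 0 k) * (i == k)%:R).
    apply: (is_derive_congr (is_deriveD (is_deriveM (dx i k x) (dx i k x)) (is_deriveZ (l 0 k) (dx i k x)))).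
      by move=> y; rewrite expr2.
    by rewrite /GRing.scale/=; ring.
  apply: (is_derive_congr (is_deriveD (is_derive_sum h1) (is_derive_cst c x (delta_mx 0 i)))).
    by move=> y; rewrite -big_split /=; congr (_ + _); rewrite fct_sumE.
  rewrite addr0 (bigD1 i)//= eqxx mulr1 big1 ?addr0// => k /negbTE.
  by rewrite eq_sym => ->; rewrite mulr0.
- move=> i j x.
  apply: (is_derive_congr (is_deriveD (is_deriveZ 2 (dx i j x)) (is_derive_cst (l 0 j) x (delta_mx 0 i)))) => //.
  by rewrite addr0.
- by move=> i j x; rewrite eq_sym.
Qed.

(* The factor [b] may take arbitrary junk values outside [Omega]. *)
Section CutOff.
Variables (Omega V : set 'rV[R]_n) (oO : open Omega) (oV : open V).
Hypothesis OV : ~` Omega `<=` V.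

Lemma cutoff_continuous (a b : 'rV[R]_n -> R) : continuous a ->
  (forall x, V x -> a x = 0) -> (forall x, Omega x -> {for x, continuous b}) ->
  continuous (fun x => a x * b x).
Proof.
move=> ca a0 cb x; have [Ox|nOx] := pselect (Omega x).
  have cax : a y @[y --> x] --> a x by exact: ca.
  have cbx : b y @[y --> x] --> b x by exact: cb.
  exact: (cvgM cax cbx).
have Vx : V x by exact: OV.
suff : a y * b y @[y --> x] --> a x * b x by [].
rewrite a0// mul0r; apply: (@cvg_near_cst _ _ _ _ (nbhs x)).
by apply: filterS (near_open oV Vx) => y Vy; rewrite a0// mul0r.
Qed.

Lemma cutoff_derive (a b : 'rV[R]_n -> R) (x v : 'rV[R]_n) (a' b' : R) :
  is_derive x v a a' -> (Omega x -> is_derive x v b b') ->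
  (forall x, V x -> a x = 0) -> (V x -> a' = 0) ->
  is_derive x v (fun x => a x * b x) (a' * b x + a x * b').
Proof.
move=> da db a0 a'0; have [Ox|nOx] := pselect (Omega x).
  apply: (is_derive_congr (is_deriveM da (db Ox))) => //.
  by rewrite /GRing.scale/=; ring.
have Vx : V x by exact: OV.
rewrite a0// a'0// !mul0r addr0; apply: near_eq_is_derive (is_derive_cst 0 x v).
by apply: filterS (near_open oV Vx) => y Vy; rewrite a0// mul0r.
Qed.

Lemma C2fun_cutoff (T : 'rV[R]_n -> R) DT D2T (W : 'rV[R]_n -> R) :
  C2_on Omega W -> C2fun T DT D2T -> (forall x, V x -> T x = 0) ->
  (forall i x, V x -> DT i x = 0) -> (forall i j x, V x -> D2T i j x = 0) ->
  C2fun (fun x => T x * W x) (fun i x => DT i x * W x + T x * partial W i x)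
   (fun i j x => D2T i j x * W x + DT j x * partial W i x
      + (DT i x * partial W j x + T x * hessian W x i j)).
Proof.
move=> C2W [cT cT1 cT2 dT dT1 sT] T0 T1 T2; have [C1W C1W'] := C2W.
have cW x : Omega x -> {for x, continuous W}.
  by move=> Ox; apply: differentiable_continuous; have [] := C1W x Ox.
have cW1 i x : Omega x -> {for x, continuous (partial W i)}.
  by move=> Ox; have [_] := C1W x Ox; exact.
have cW2 i j x : Omega x -> {for x, continuous (fun x => hessian W x i j)}.
  move=> Ox; have [_ /(_ i)] := C1W' j x Ox.
  by rewrite (_ : partial _ i = fun x => hessian W x i j)//; apply/funext => y; rewrite mxE.
have dW i x : Omega x -> is_derive x (delta_mx 0 i) W (partial W i x).
  by move=> Ox; apply: is_derive_partial; have [] := C1W x Ox.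
have dW1 i j x : Omega x -> is_derive x (delta_mx 0 i) (partial W j) (hessian W x i j).
  by move=> Ox; rewrite mxE; apply: is_derive_partial; have [] := C1W' j x Ox.
split.
- exact: cutoff_continuous.
- by move=> i; apply: contD; apply: cutoff_continuous => //; [exact: T1|exact: cW1].
- move=> i j; apply: contD; apply: contD; apply: cutoff_continuous => //.
  + exact: T2. + exact: T1. + exact: cW1. + exact: T1. + exact: cW1. + exact: cW2.
- by move=> i x; apply: cutoff_derive => //; solve [exact: dW|exact: T1].
- move=> i j x.
  apply: is_deriveD; apply: cutoff_derive => //;
    solve [exact: dW|exact: dW1|exact: T1|exact: T2].
- move=> i j x; rewrite sT; have [Ox|nOx] := pselect (Omega x).
    have -> : hessian W x j i = hessian W x i j.
      by rewrite -{1}(hessian_sym oO C2W Ox) mxE.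
    by ring.
  by rewrite !T1 ?T0 ?mul0r//; exact: OV.
Qed.

End CutOff.

End C2Bundle.

(** * A smooth convex penalty separating a compact convex set from the outside *)

Section Separation.
Variables (R : realType) (n : nat).
Implicit Types (x y z : 'rV[R]_n) (Omega K A : set 'rV[R]_n).

Lemma compact_thickening K Omega : compact K -> open Omega -> K `<=` Omega ->
  exists2 d : R, 0 < d & forall x y, K x -> `|x - y| < d -> Omega y.
Proof.
move=> cK oO KO.
have : \forall d \near (0 : R)^'+, forall x, K x -> forall y, `|x - y| < d -> Omega y.
  have /compact_near_coveringP := cK.
  move=> /(_ _ _ (fun d x => forall y, `|x - y| < d -> Omega y) _); apply => x Kx.
  have /nbhs_ballP[r /= r0 hr] := near_open oO (KO x Kx).
  near=> z d => y zy; apply: hr; rewrite -ball_normE/=.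
  have xz : `|x - z| < r / 2.
    by near: z; apply: cvgr_dist_lt; [exact: cvg_id|rewrite divr_gt0].
  have dr : d < r / 2 by near: d; apply: nbhs_right_lt; rewrite divr_gt0.
  rewrite (_ : x - y = (x - z) + (z - y)); last by rewrite addrA subrK.
  rewrite (le_lt_trans (ler_normD _ _))// [ltRHS]splitr.
  by rewrite ltrD// (lt_trans zy).
move=> h; near (0 : R)^'+ => d; exists d.
  by near: d; exact: nbhs_right_gt.
have hd : forall x, K x -> forall y, `|x - y| < d -> Omega y by near: d.
by move=> x y Kx; exact: hd.
Unshelve. all: by end_near. Qed.

(** For bounded convex [Omega] and [d] from [compact_thickening], this is the compact convex set
    squeezed between [K] and [Omega]. *)
Definition erosion Omega (d : R) : set 'rV[R]_n := [set x | forall y, `|x - y| < d -> Omega y].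

Lemma erosion_sub Omega d : 0 < d -> erosion Omega d `<=` Omega.
Proof. by move=> d0 x; apply; rewrite subrr normr0. Qed.

Lemma erosion_closed Omega d : closed (erosion Omega d).
Proof.
move=> x clx y xy; have e0 : 0 < d - `|x - y| by rewrite subr_gt0.
have [z [cz /=]] := clx _ (nbhsx_ballx x _ e0); rewrite -ball_normE/= => xz.
apply: cz; rewrite (_ : z - y = (z - x) + (x - y)); last by rewrite addrA subrK.
by rewrite (le_lt_trans (ler_normD _ _))// [`|z - x|]distrC; lra.
Qed.

Lemma erosion_convex Omega d : convex_set_rV Omega -> convex_set_rV (erosion Omega d).
Proof.
move=> cO x y t cx cy t01 u hu.
set v := (1 - t) *: x + t *: y in hu *.
(* Both end points are translated by the displacement [u - v], shorter than [d]. *)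
have -> : u = (1 - t) *: (x + (u - v)) + t *: (y + (u - v)).
  by rewrite /v; apply/rowP => i; rewrite !mxE; ring.
by apply: cO => //; [apply: cx|apply: cy];
  rewrite opprD addrA subrr add0r normrN distrC.
Qed.

Lemma bounded_sub A Omega : bounded_set Omega -> A `<=` Omega -> bounded_set A.
Proof.
by move=> [M [Mr hM]] AO; exists M; split => // N MN x Ax; apply: (hM N MN); exact: AO.
Qed.

(** Its nonpositive set is a Euclidean ball (possibly empty). Balls are used instead of half-spaces
    because the Hessian is then 2 I, which makes the penalty uniformly convex where [quad] is
    bounded below by a positive number. *)
Definition quad (p : 'rV[R]_n * R) y : R :=
  \sum_i y 0 i ^+ 2 + \sum_i p.1 0 i * y 0 i + p.2.

Lemma quad_continuous p : continuous (quad p).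
Proof. by have [] := C2fun_quadratic p.1 p.2. Qed.

(** With [p] the point of A nearest to [z], the quadratic is |y - p|^2 + 2 T (z - p).(y - p) - C,
    where C bounds |y - p|^2 on A and the scalar product is nonpositive on A. *)
Lemma separation A z : compact A -> convex_set_rV A -> ~ A z ->
  exists p, (forall y, A y -> quad p y <= 0) /\ 0 < quad p z.
Proof.
move=> cA vA nAz; have [A0|/set0P A0] := eqVneq A set0.
  exists (0, 1); split; first by rewrite A0.
  rewrite /quad/= [X in _ + X + _]big1 => [|i _]; last by rewrite mxE mul0r.
  by rewrite addr0 ltr_wpDl// sumr_ge0// => i _; rewrite sqr_ge0.
have cx i : continuous (fun x : 'rV[R]_n => x 0 i) by exact: coord_continuous.
have cd (w : 'rV[R]_n) : continuous (fun y : 'rV[R]_n => \sum_i (y 0 i - w 0 i) ^+ 2).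
  by apply: cont_sum => i; apply: contX; apply: contB => //; exact: contC.
have [p pA hp] := EVT_min_rV A0 cA (continuous_subspaceT (cd z)).
have [u uA hu] := EVT_max_rV A0 cA (continuous_subspaceT (cd p)).
pose C := \sum_i (u 0 i - p 0 i) ^+ 2.
have {}pA : A p by exact: set_mem.
pose D := \sum_i (z 0 i - p 0 i) ^+ 2.
have D0 : 0 < D.
  rewrite lt_neqAle sumr_ge0 ?andbT; last by move=> i _; rewrite sqr_ge0.
  rewrite eq_sym psumr_eq0; last by move=> i _; rewrite sqr_ge0.
  apply/negP => /allP h; apply: nAz; rewrite (_ : z = p)//; apply/rowP => i.
  have := h i (mem_index_enum _); rewrite sqrf_eq0 subr_eq0 => /eqP h'.
  by rewrite [LHS]h'.
(* This makes 2 T D = C, so the value at [z] is D > 0. *)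
pose T := C / (2 * D).
exists (\row_i (- 2 * p 0 i + 2 * T * (z 0 i - p 0 i)),
  \sum_i p 0 i ^+ 2 - 2 * T * (\sum_i (z 0 i - p 0 i) * p 0 i) - C).
have E y : quad (\row_i (- 2 * p 0 i + 2 * T * (z 0 i - p 0 i)),
  \sum_i p 0 i ^+ 2 - 2 * T * (\sum_i (z 0 i - p 0 i) * p 0 i) - C) y =
  \sum_i (y 0 i - p 0 i) ^+ 2 + 2 * T * (\sum_i (z 0 i - p 0 i) * (y 0 i - p 0 i)) - C.
  rewrite /quad/= !addrA; congr (_ - _).
  rewrite !mulr_sumr -!big_split/= -sumrN -!big_split/=.
  by apply: eq_bigr => i _; rewrite !mxE; ring.
split; last first.
  rewrite E.
  have -> : \sum_i (z 0 i - p 0 i) * (z 0 i - p 0 i) = D.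
    by apply: eq_bigr => i _; rewrite expr2.
  by rewrite -/D /T [_ * (C / _)]mulrC -mulrA mulfVK ?addrK// mulf_neq0// gt_eqF.
move=> y Ay; rewrite E.
have le0 : \sum_i (z 0 i - p 0 i) * (y 0 i - p 0 i) <= 0.
  set S := \sum_i _; rewrite leNgt; apply/negP => S0.
  pose Y := \sum_i (y 0 i - p 0 i) ^+ 2.
  have Y0 : 0 <= Y by rewrite sumr_ge0// => i _; rewrite sqr_ge0.
  (* Were S > 0, moving from [p] towards [y] by this [t] would stay in A and change the squared
     distance to [z] by t^2 Y - 2 t S < 0. *)
  pose t := Num.min 1 (S / (Y + 1)).
  have Y1 : 0 < Y + 1 by rewrite ltr_wpDl.
  have t0 : 0 < t by rewrite lt_min ltr01 divr_gt0.
  have t1 : t <= 1 by rewrite ge_min lexx.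
  have tS : t * (Y + 1) <= S by rewrite -ler_pdivlMr// ge_min lexx orbT.
  have At : A ((1 - t) *: p + t *: y) by apply: vA => //; rewrite (ltW t0).
  have := hp _ (mem_set At).
  have -> : \sum_i (((1 - t) *: p + t *: y) 0 i - z 0 i) ^+ 2 =
    \sum_i (p 0 i - z 0 i) ^+ 2 - 2 * t * S + t ^+ 2 * Y.
    rewrite /S /Y !mulr_sumr -sumrN -!big_split/=.
    by apply: eq_bigr => i _; rewrite !mxE; ring.
  have : t * (t * (Y + 1)) <= t * S by rewrite ler_pM2l.
  have : 0 < t * S by rewrite mulr_gt0.
  have : 0 <= t ^+ 2 by rewrite sqr_ge0.
  by move=> a1 a2 a3; lra.
have T0 : 0 <= T.
  by rewrite divr_ge0 ?mulr_ge0 ?(ltW D0)// sumr_ge0// => i _; rewrite sqr_ge0.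
have := hu _ (mem_set Ay); rewrite -/C => YC.
have : T * (\sum_i (z 0 i - p 0 i) * (y 0 i - p 0 i)) <= 0 by rewrite mulr_ge0_le0.
by lra.
Qed.

Definition penalty (s : seq ('rV[R]_n * R)) y : R :=
  \sum_(p <- s) Num.max (quad p y) 0 ^+ 3.

Lemma penalty_continuous s : continuous (penalty s).
Proof.
apply: cont_sum => p; apply: contX.
exact: (cont_comp (@quad_continuous p) (@continuous_maxr R 0)).
Qed.

Lemma maxr0_ge0 (t : R) : 0 <= Num.max t 0.
Proof. by rewrite le_max lexx orbT. Qed.

Lemma penalty_ge (s : seq ('rV[R]_n * R)) p y : p \in s ->
  Num.max (quad p y) 0 ^+ 3 <= penalty s y.
Proof.
move=> ps; rewrite /penalty (big_rem p)//= lerDl sumr_ge0// => q _.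
by rewrite exprn_ge0// maxr0_ge0.
Qed.

Lemma penalty_exists Omega A : open Omega -> compact A -> convex_set_rV A ->
  A `<=` Omega ->
  exists s, (forall p y, p \in s -> A y -> quad p y <= 0) /\
    exists2 eta, 0 < eta & forall y, ~ Omega y -> eta <= penalty s y.
Proof.
move=> oO cA vA AO.
have cx i : continuous (fun x : 'rV[R]_n => x 0 i) by exact: coord_continuous.
have csq : continuous (fun y : 'rV[R]_n => \sum_i y 0 i ^+ 2).
  by apply: cont_sum => i; exact: contX.
have sq0 (y : 'rV[R]_n) : 0 <= \sum_i y 0 i ^+ 2 by rewrite sumr_ge0// => i _; rewrite sqr_ge0.
have [C [C0 hC]] : exists C : R, 0 <= C /\ forall y, A y -> \sum_i y 0 i ^+ 2 <= C.
  have [A0|/set0P A0] := eqVneq A set0; first by exists 0; rewrite A0.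
  have [u uA hu] := EVT_max_rV A0 cA (continuous_subspaceT csq).
  by exists (\sum_i u 0 i ^+ 2); split => // y /mem_set; exact: hu.
pose N := [set y : 'rV[R]_n | \sum_i y 0 i ^+ 2 <= C + 1] `&` ~` Omega.
have cN : compact N.
  apply: (subclosed_compact _ (@box_compact R (C + 1 + 1) n)).
    apply: closedI; last exact: open_closedC.
    rewrite (_ : [set _ | _] = (fun y : 'rV[R]_n => \sum_i y 0 i ^+ 2) @^-1` [set t | t <= C + 1])//.
    by apply: preimage_closed => //; exact: closed_le.
  move=> y [/= hy _] i; rewrite leNgt; apply/negP => h.
  have h1 : y 0 i ^+ 2 <= C + 1.
    apply: le_trans hy; rewrite (bigD1 i)//= lerDl sumr_ge0// => j _.
    by rewrite sqr_ge0.
  have h2 : (C + 1 + 1) * (C + 1 + 1) < `|y 0 i| * `|y 0 i|.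
    by rewrite ltr_pM// addr_ge0// addr_ge0.
  move: h2; rewrite -expr2 -normrM -expr2 ger0_norm ?sqr_ge0// => h2.
  have : (C + 1 + 1) ^+ 2 = C ^+ 2 + 4 * C + 4 by ring.
  by have := sqr_ge0 C => ? e; rewrite e in h2; lra.
have := cN; rewrite compact_cover.
pose D : set ('rV[R]_n * R)%type := [set p | forall y, A y -> quad p y <= 0].
move=> /(_ _ D (fun p => [set y | 0 < quad p y])) [||D' D'D ND'].
- move=> p _; apply: (@open_comp _ _ (quad p) [set t | 0 < t]).
    by move=> y _; exact: quad_continuous.
  exact: open_gt.
- move=> z [_ nOz]; have [|p [h1 h2]] := separation cA vA (z := z).
    by move/AO.
  by exists p.
(* A finite subcover handles only the bounded part of the complement of [Omega]; [q0] makes the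
   penalty at least 1 where |y|^2 > C + 1. *)
pose q0 : 'rV[R]_n * R := (0, - C).
have q0E y : quad q0 y = \sum_i y 0 i ^+ 2 - C.
  by rewrite /quad/= [X in _ + X + _]big1 ?addr0// => i _; rewrite mxE mul0r.
pose s := q0 :: finmap.enum_fset D'.
exists s; split.
  move=> p y; rewrite inE => /orP[/eqP -> Ay|pD Ay].
    by rewrite q0E subr_le0 hC.
  by have := D'D p pD; rewrite inE => h; exact: h.
have Hpos y : N y -> 0 < penalty s y.
  move=> /ND' [p /= pD qp]; apply: lt_le_trans (penalty_ge (p := p) y _); last first.
    by rewrite inE orbC pD.
  by rewrite exprn_gt0// lt_max qp.
have [e [e0 he]] : exists e : R, 0 < e /\ forall y, N y -> e <= penalty s y.
  have [N0|/set0P N0] := eqVneq N set0; first by exists 1; rewrite N0.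
  have [u uN hu] := EVT_min_rV N0 cN (continuous_subspaceT (@penalty_continuous s)).
  exists (penalty s u); split; first exact/Hpos/set_mem.
  by move=> y /mem_set; exact: hu.
exists (Num.min e 1); first by rewrite lt_min e0 ltr01.
move=> y nOy; have [hy|hy] := leP (\sum_i y 0 i ^+ 2) (C + 1).
  by rewrite ge_min he.
rewrite ge_min; apply/orP; right.
apply: le_trans (penalty_ge (p := q0) y _); last by rewrite inE eqxx.
have : 1 <= Num.max (quad q0 y) 0 by rewrite le_max q0E; apply/orP; left; lra.
by move=> h; rewrite exprn_ege1.
Qed.

End Separation.

(** * Extension of W to a concave C^2 function *)

Section ConcaveExtension.
Variables (R : realType) (n : nat).
Implicit Types (x y z : 'rV[R]_n) (Omega K A : set 'rV[R]_n).

Lemma qform_le_norm (B : 'M[R]_n) (C : R) (w : 'I_n -> R) :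
  (forall i j, `|B i j| <= C) -> qform B w <= C * n%:R ^+ 2 * \sum_i w i ^+ 2.
Proof.
move=> hB; have S0 : 0 <= \sum_i w i ^+ 2 by rewrite sumr_ge0// => i _; rewrite sqr_ge0.
have wS i : w i ^+ 2 <= \sum_i w i ^+ 2.
  by rewrite (bigD1 i)//= lerDl sumr_ge0// => j _; rewrite sqr_ge0.
apply: (@le_trans _ _ (\sum_(i < n) \sum_(j < n) C * \sum_i w i ^+ 2)).
  apply: ler_sum => i _; apply: ler_sum => j _.
  apply: (le_trans (ler_norm _)); rewrite normrM mulrC.
  apply: ler_pM => //; rewrite ler_norml.
  have := wS i; have := wS j; have := sqr_ge0 (w i - w j); have := sqr_ge0 (w i + w j).
  by move=> a1 a2 a3 a4; apply/andP; split; lra.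
rewrite !sumr_const !card_ord.
by rewrite -mulrnA -(mulr_natr _ (n * n)) natrM -expr2 mulrAC.
Qed.

Lemma qformD (A B : 'M[R]_n) (a : R) w : qform (A + a *: B) w = qform A w + a * qform B w.
Proof.
rewrite /qform mulr_sumr -big_split/=; apply: eq_bigr => i _.
rewrite mulr_sumr -big_split/=; apply: eq_bigr => j _.
by rewrite !mxE; ring.
Qed.

Lemma compact_lower_bound A (F : 'rV[R]_n -> R) : compact A -> continuous F ->
  (forall x, A x -> 0 < F x) -> exists2 c, 0 < c & forall x, A x -> c <= F x.
Proof.
move=> cA cF F0; have [A0|/set0P A0] := eqVneq A set0; first by exists 1; rewrite ?A0.
have [u uA hu] := EVT_min_rV A0 cA (continuous_subspaceT cF).
by exists (F u); [exact/F0/set_mem|move=> x /mem_set; exact: hu].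
Qed.

Lemma compact_upper_bound A (F : 'rV[R]_n -> R) : compact A -> continuous F ->
  exists2 c, 0 <= c & forall x, A x -> F x <= c.
Proof.
move=> cA cF; have [A0|/set0P A0] := eqVneq A set0; first by exists 0; rewrite ?A0.
have [u uA hu] := EVT_max_rV A0 cA (continuous_subspaceT cF).
exists (`|F u|) => // x /mem_set xA.
by rewrite (le_trans (hu _ xA))// ler_norm.
Qed.

Let pos (t : R) := Num.max t 0.
Let pen1 (s : seq ('rV[R]_n * R)) i x :=
  \sum_(p <- s) 3 * pos (quad p x) ^+ 2 * (2 * x 0 i + p.1 0 i).
Let pen2 (s : seq ('rV[R]_n * R)) (i j : 'I_n) x :=
  \sum_(p <- s) (3 * (2 * pos (quad p x)) * (2 * x 0 i + p.1 0 i) * (2 * x 0 j + p.1 0 j)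
     + 3 * pos (quad p x) ^+ 2 * (2 * (i == j)%:R)).

Let penalty_C2 s : C2fun (penalty s) (pen1 s) (pen2 s).
Proof.
apply: (@C2fun_sum R n _ s (fun p x => pos (quad p x) ^+ 3)
  (fun p i x => 3 * pos (quad p x) ^+ 2 * (2 * x 0 i + p.1 0 i))
  (fun p i j x => 3 * (2 * pos (quad p x)) * (2 * x 0 i + p.1 0 i) * (2 * x 0 j + p.1 0 j)
     + 3 * pos (quad p x) ^+ 2 * (2 * (i == j)%:R))) => p.
apply: (@C2fun_comp R n (fun t => pos t ^+ 3) (fun t => 3 * pos t ^+ 2) (fun t => 3 * (2 * pos t))).
- by move=> t; exact: (is_derive_pos 1).
- move=> t; apply: (is_derive_congr (is_deriveZ 3 (is_derive_pos 0 t))) => //.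
- by apply: contM; [exact: contC|apply: contM; [exact: contC|exact: continuous_maxr]].
- exact: C2fun_quadratic.
Qed.

(** Each cube contributes a square of the gradient, which is dropped, and 3 max(quad, 0)^2 times the
    Hessian 2 I, which gives the factor 6. *)
Let penalty_hessian_ge s x (w : 'I_n -> R) :
  6 * (\sum_(p <- s) pos (quad p x) ^+ 2) * (\sum_i w i ^+ 2) <=
  qform (\matrix_(i, j) pen2 s i j x) w.
Proof.
have -> : qform (\matrix_(i, j) pen2 s i j x) w =
  \sum_(p <- s) (6 * pos (quad p x) * (\sum_i w i * (2 * x 0 i + p.1 0 i)) ^+ 2
    + 6 * pos (quad p x) ^+ 2 * (\sum_i w i ^+ 2)).
  rewrite /qform.
  transitivity (\sum_i \sum_j \sum_(p <- s) (w i * w j *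
    (3 * (2 * pos (quad p x)) * (2 * x 0 i + p.1 0 i) * (2 * x 0 j + p.1 0 j)
     + 3 * pos (quad p x) ^+ 2 * (2 * (i == j)%:R)))).
    by apply: eq_bigr => i _; apply: eq_bigr => j _; rewrite mxE mulr_sumr.
  under eq_bigr do rewrite exchange_big/=.
  rewrite exchange_big/=; apply: eq_bigr => p _.
  transitivity (\sum_i (6 * pos (quad p x) * (w i * (2 * x 0 i + p.1 0 i) *
     \sum_j w j * (2 * x 0 j + p.1 0 j)) + 6 * pos (quad p x) ^+ 2 * w i ^+ 2)).
    apply: eq_bigr => i _.
    under eq_bigr do rewrite mulrDr.
    rewrite big_split/=; congr (_ + _).
      by rewrite !mulr_sumr; apply: eq_bigr => j _; ring.
    rewrite (bigD1 i)//= eqxx big1; last first.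
      by move=> j /negbTE ji; rewrite eq_sym ji !mulr0.
    by rewrite mulr1n; ring.
  by rewrite big_split/= -!mulr_sumr -mulr_suml -expr2.
rewrite mulr_sumr mulr_suml; apply: ler_sum => p _.
by rewrite lerDr mulr_ge0 ?sqr_ge0// mulr_ge0// maxr0_ge0.
Qed.

(* [U = th(H) W - M H], where the convex penalty [H] vanishes on [K] and exceeds [eta]
   off [Omega]; [D^2 H] is bounded below where the cutoff [th(H)] varies. *)
Theorem concave_extension Omega K (W : 'rV[R]_n -> R) : open Omega -> bounded_set Omega ->
  convex_set_rV Omega -> C2_on Omega W -> concave_on Omega W -> compact K -> K `<=` Omega ->
  exists U DU D2U, [/\ C2fun U DU D2U,
    (forall x w, qform (\matrix_(i, j) D2U i j x) w <= 0) &
    (forall x, K x -> U x = W x /\ \matrix_(i, j) D2U i j x = hessian W x)].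
Proof.
move=> oO bO vO C2W cW cK KO.
have [d d0 hd] := compact_thickening cK oO KO.
pose A := erosion Omega d.
have AO : A `<=` Omega by exact: erosion_sub.
have cA : compact A.
  by apply: bounded_closed_compact; [exact: bounded_sub AO|exact: erosion_closed].
have [s [sA [eta eta0 heta]]] := penalty_exists oO cA (@erosion_convex _ _ _ _ vO) AO.
pose e1 := eta / 3; pose e2 := 2 * eta / 3.
have e12 : e1 < e2 by rewrite /e1 /e2; lra.
have [th [th1 [th2 [dth dth1 cth2 th_ge0 [thl thr]]]]] := cutoff e12.
have C2H := penalty_C2 s; set H := penalty s in C2H *.
have [cH cH1 cH2 _ _ _] := C2H.
have C2T := C2fun_comp dth dth1 cth2 C2H.
pose V := [set x | e2 < H x].
have oV : open V.
  by apply: (@open_comp _ _ H [set t | e2 < t]); [move=> y _; exact: cH|exact: open_gt].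
have OV : ~` Omega `<=` V.
  by move=> x /heta; apply: lt_le_trans; rewrite /e2; lra.
have T0 x : V x -> th (H x) = 0 by move=> /ltW /thr [].
have T1 x : V x -> th1 (H x) = 0 by move=> /ltW /thr [].
have T2 x : V x -> th2 (H x) = 0 by move=> /ltW /thr [].
have DT0 i x : V x -> th1 (H x) * pen1 s i x = 0 by move/T1 ->; rewrite mul0r.
have D2T0 i j x : V x -> th2 (H x) * pen1 s i x * pen1 s j x + th1 (H x) * pen2 s i j x = 0.
  by move=> Vx; rewrite T2// T1// !mul0r addr0.
have C2TW := C2fun_cutoff oO oV OV C2W C2T T0 DT0 D2T0.
(* [B] gathers the terms of the Hessian of th(H) W in which the cutoff is differentiated; the other
   term, th(H) times the Hessian of W, is already nonpositive. *)
pose B i j x := (th2 (H x) * pen1 s i x * pen1 s j x + th1 (H x) * pen2 s i j x) * W x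
  + th1 (H x) * pen1 s j x * partial W i x + th1 (H x) * pen1 s i x * partial W j x.
have [_ cT1 cT2 _ _ _] := C2T.
have cB i j : continuous (B i j).
  have cWx x : Omega x -> {for x, continuous W}.
    by move=> Ox; apply: differentiable_continuous; have [] := proj1 C2W x Ox.
  have cW1 k x : Omega x -> {for x, continuous (partial W k)}.
    by move=> Ox; have [_] := proj1 C2W x Ox; exact.
  apply: contD; first apply: contD.
  - exact: (cutoff_continuous oV OV (cT2 i j) (D2T0 i j) cWx).
  - exact: (cutoff_continuous oV OV (cT1 j) (DT0 j) (cW1 i)).
  - exact: (cutoff_continuous oV OV (cT1 i) (DT0 i) (cW1 j)).
(* Outside the transition zone [Z] the matrix [B] vanishes. [Z] is compact because H >= eta > e2 off
   the bounded set [Omega]. *)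
pose Z := [set x | e1 <= H x] `&` [set x | H x <= e2].
have cZ : compact Z.
  apply: bounded_closed_compact.
    apply: (bounded_sub bO) => x [_ /= hx]; apply: contrapT => /heta.
    by rewrite -/(H x) => h; rewrite /e2 in hx; lra.
  apply: closedI.
    by apply: (@preimage_closed _ _ H [set t | e1 <= t]) => //; exact: closed_ge.
  by apply: (@preimage_closed _ _ H [set t | t <= e2]) => //; exact: closed_le.
have [C C0 hC] : exists2 C : R, 0 <= C & forall x, Z x -> forall i j, `|B i j x| <= C.
  have cS : continuous (fun x => \sum_i \sum_j `|B i j x|).
    apply: cont_sum => i; apply: cont_sum => j.
    by apply: cont_comp (cB i j) _; exact: norm_continuous.
  have [C C0 hC] := compact_upper_bound cZ cS; exists C => // x Zx i j.
  apply: le_trans (hC x Zx); rewrite (bigD1 i)//= (bigD1 j)//= -addrA lerDl addr_ge0//.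
    by rewrite sumr_ge0.
  by rewrite sumr_ge0// => k _; rewrite sumr_ge0.
pose Y x := \sum_(p <- s) pos (quad p x) ^+ 2.
have cY : continuous Y.
  apply: cont_sum => p; apply: contX.
  exact: (cont_comp (@quad_continuous _ _ p) (@continuous_maxr R 0)).
have Y_ge0 x : 0 <= Y x by rewrite sumr_ge0// => p _; rewrite sqr_ge0.
(* On [Z] the penalty is positive, so some [quad] is; compactness gives a uniform bound. *)
have [y0 y00 hy0] : exists2 y0, 0 < y0 & forall x, Z x -> y0 <= Y x.
  apply: compact_lower_bound => // x [/= hx _]; rewrite lt_neqAle Y_ge0 andbT eq_sym.
  apply/eqP => Y0; have : 0 < H x by rewrite (lt_le_trans _ hx)// /e1; lra.
  rewrite [H x]big1_seq ?ltxx// => p /= ps.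
  move/eqP: Y0; rewrite psumr_eq0; last by move=> q _; rewrite sqr_ge0.
  by move=> /allP /(_ p ps); rewrite /= sqrf_eq0 => /eqP; rewrite /pos => ->; rewrite expr0n.
(* On [Z] the form of [B] is at most C n^2 |w|^2 and that of the Hessian of H is at least 6 y0
   |w|^2; this ratio balances them. *)
pose M := C * n%:R ^+ 2 / (6 * y0).
have M0 : 0 <= M by rewrite divr_ge0 ?mulr_ge0 ?exprn_ge0// ltW.
have C2U := C2fun_add (- M) C2TW C2H.
eexists; eexists; eexists; split; first exact: C2U.
- move=> x w.
  set D2 := \matrix_(i, j) _.
  have -> : D2 = \matrix_(i, j) B i j x + th (H x) *: hessian W x + - M *: \matrix_(i, j) pen2 s i j x.
    by apply/matrixP => i j; rewrite !mxE /B; ring.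
  rewrite !qformD.
  have S0 : 0 <= \sum_i w i ^+ 2 by rewrite sumr_ge0// => i _; rewrite sqr_ge0.
  have hP := penalty_hessian_ge s x w.
  have hW : th (H x) * qform (hessian W x) w <= 0.
    have [Ox|nOx] := pselect (Omega x); last by rewrite T0 ?mul0r//; exact: OV.
    by rewrite mulr_ge0_le0// (hessian_nsd oO w C2W Ox cW).
  have hP0 : 0 <= M * qform (\matrix_(i, j) pen2 s i j x) w.
    by rewrite mulr_ge0// (le_trans _ hP)// !mulr_ge0// Y_ge0.
  have [Zx|nZx] := pselect (Z x).
    have hB : qform (\matrix_(i, j) B i j x) w <= C * n%:R ^+ 2 * \sum_i w i ^+ 2.
      by apply: qform_le_norm => i j; rewrite mxE; exact: hC.
    have : M * (6 * y0 * \sum_i w i ^+ 2) <= M * qform (\matrix_(i, j) pen2 s i j x) w.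
      rewrite ler_wpM2l// (le_trans _ hP)// ler_wpM2r// ler_wpM2l//; exact: hy0.
    by rewrite mulrA /M mulfVK ?mulf_neq0 ?gt_eqF// => h; lra.
  have -> : qform (\matrix_(i, j) B i j x) w = 0.
    rewrite /qform big1// => i _; rewrite big1// => j _; rewrite mxE /B.
    have [h|h] := ltP (H x) e1.
      by have [_ -> ->] := thl _ (ltW h); rewrite !mul0r !addr0 mul0r mulr0.
    have Vx : V x by rewrite /V/= ltNge; apply/negP => h'; apply: nZx.
    by rewrite T1// T2// !mul0r !addr0 mul0r mulr0.
  by lra.
move=> x Kx.
have Ax : A x by move=> y; exact: hd.
have q0 p : p \in s -> pos (quad p x) = 0.
  by move=> ps; rewrite /pos max_r//; exact: sA.
have H0 : H x = 0 by rewrite [H x]big1_seq// => p /q0; rewrite /pos => ->; rewrite expr0n.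
have P2 i j : pen2 s i j x = 0.
  by rewrite /pen2 big1_seq// => p /q0 ->; rewrite expr0n/= !(mul0r, mulr0) addr0.
have [|t0 t1 t2] := thl (H x); first by rewrite H0 /e1; lra.
split; first by rewrite /= t0 H0 mul1r mulr0 addr0.
apply/matrixP => i j; rewrite mxE /= t0 t1 t2 P2 !(mul0r, mulr0, add0r, addr0, mul1r)//.
Qed.

End ConcaveExtension.

(** * The case kappa > 0 *)

Section PositiveExponent.
Variable R : realType.

(* The power [s ^ b] continued below [s0] by an exponential: this keeps the
   antiderivative nonnegative and log-concave on the whole line. *)
Lemma extended_power (b s0 : R) : 0 < b -> 0 < s0 ->
  exists phi r dr : R -> R,
  [/\ (forall s : R, is_derive s 1 phi (r s)), (forall s : R, is_derive s 1 r (dr s)),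
      continuous dr, (forall s, 0 < r s) &
      [/\ (forall s, 0 < dr s), (forall s, phi s <= r s ^+ 2 / dr s),
      (forall s, 0 <= phi s), (forall s, s0 <= s -> r s = s `^ b) &
      (forall s, s0 <= s -> dr s = b * (s `^ b / s))]].
Proof.
(* [l] is the logarithmic derivative of s^b at [s0], so that [dr] is continuous; [k] below makes
   [phi] continuous there. *)
move=> b0 s00; pose l := b / s0.
have l0 : 0 < l by rewrite divr_gt0.
pose c := s0 `^ b; have c0 : 0 < c by rewrite powR_gt0.
pose E s := c * expR (l * (s - s0)).
have E0 s : 0 < E s by rewrite mulr_gt0// expR_gt0.
have dE (s : R) : is_derive s 1 E (l * E s).
  have d1 : is_derive s 1 (fun s : R => l * (s - s0)) l.
    apply: (is_derive_congr (is_deriveZ l (is_deriveB (is_derive_id s 1) (is_derive_cst s0 s 1)))) => //.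
    by rewrite subr0 /GRing.scale/= mulr1.
  apply: (is_derive_congr (is_deriveZ c (is_derive_chain d1 (is_derive_expR _)))) => //.
  by rewrite /GRing.scale/= /E; ring.
have Es0 : E s0 = c by rewrite /E subrr mulr0 expR0 mulr1.
pose k := s0 `^ (b + 1) / b - s0 `^ (b + 1) / (b + 1).
have b1 : 0 < b + 1 by rewrite addr_gt0.
have s0b : s0 `^ (b + 1) = s0 * c by rewrite powRD ?(gt_eqF b1)// powRr1 ?(ltW s00)// mulrC.
pose phi s := if s0 <= s then (b + 1)^-1 * s `^ (b + 1) + k else l^-1 * E s.
pose r s := if s0 <= s then s `^ b else E s.
pose dr s := if s0 <= s then b * s `^ (b - 1) else l * E s.
have spos s : s0 <= s -> 0 < s by exact: lt_le_trans.
have r0 s : 0 < r s.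
  by rewrite /r; case: ifP => // s0s; rewrite powR_gt0// spos.
have drE s : dr s = b * (r s / Num.max s s0).
  rewrite /dr /r; case: (leP s0 s) => s0s; last by rewrite /l; ring.
  by rewrite powR_sub1// spos.
have drv (s : R) : is_derive s 1 r (dr s).
  apply: is_derive_glue.
  - by rewrite Es0.
  - by move=> s0s; apply: is_derive1_powR; exact: spos.
  - by move=> ->; rewrite powR_sub1// Es0 /l /c; ring.
have l_neq0 : l != 0 by rewrite gt_eqF.
have b_neq0 : b != 0 by rewrite gt_eqF.
have b1_neq0 : b + 1 != 0 by rewrite gt_eqF.
have s0_neq0 : s0 != 0 by rewrite gt_eqF.
have dphi (s : R) : is_derive s 1 phi (r s).
  apply: is_derive_glue.
  - by rewrite Es0 /k s0b /l; field; rewrite b_neq0 b1_neq0 s0_neq0.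
  - move=> s0s.
    apply: (is_derive_congr (is_deriveD (is_deriveZ (b + 1)^-1 (is_derive1_powR (b + 1) (spos _ s0s)))
      (is_derive_cst k s 1))) => //.
    by rewrite addr0 /GRing.scale/= mulKf// addrK.
  - move=> _; apply: (is_derive_congr (is_deriveZ l^-1 (dE s))) => //.
    by rewrite /GRing.scale/= mulKf.
  - by move=> ->; rewrite Es0.
have kk : 0 <= b^-1 - (b + 1)^-1.
  by rewrite subr_ge0 lef_pV2 ?posrE// lerDl.
have k0 : 0 <= k.
  by rewrite /k -mulrBr mulr_ge0// powR_ge0.
exists phi, r, dr; split => //.
  rewrite (funext drE); apply: contM; first exact: contC.
  apply: contM; first by move=> s; apply: is_derive_continuous; exact: drv.
  apply: contV; last exact: continuous_maxr.
  by move=> s; rewrite gt_eqF// lt_max s00 orbT.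
split.
- by move=> s; rewrite drE mulr_gt0// divr_gt0// lt_max s00 orbT.
(* Above [s0] the gap is (1/b - 1/(b+1)) (s^(b+1) - s0^(b+1)), which is nonnegative; on the
   exponential piece there is equality. *)
- move=> s; rewrite /phi /r /dr; case: ifP => s0s.
    have sp := spos _ s0s; have sn : s != 0 by rewrite gt_eqF.
    have p0 : 0 < s `^ b by rewrite powR_gt0.
    have sb : s `^ (b + 1) = s * s `^ b by rewrite powRD ?(gt_eqF b1)// powRr1 ?(ltW sp)// mulrC.
    have -> : (s `^ b) ^+ 2 / (b * s `^ (b - 1)) = b^-1 * s `^ (b + 1).
      rewrite sb powR_sub1//; have pn : s `^ b != 0 by rewrite gt_eqF.
      by field; rewrite sn pn b_neq0.
    have mono : s0 `^ (b + 1) <= s `^ (b + 1).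
      have := @ge0_ler_powR R (b + 1) (ltW b1) s0 s; rewrite !nnegrE (ltW s00) (ltW sp).
      by apply.
    have : 0 <= (b^-1 - (b + 1)^-1) * (s `^ (b + 1) - s0 `^ (b + 1)).
      by rewrite mulr_ge0// subr_ge0.
    by rewrite /k => h; lra.
  have En : E s != 0 by rewrite gt_eqF.
  have -> // : E s ^+ 2 / (l * E s) = l^-1 * E s by field; rewrite l_neq0 En.
- move=> s; rewrite /phi; case: ifP => s0s.
    by rewrite addr_ge0// mulr_ge0 ?powR_ge0// invr_ge0 ltW.
  by apply: mulr_ge0; rewrite ?invr_ge0 ltW.
- by move=> s s0s; rewrite /r s0s.
- by move=> s s0s; rewrite /dr s0s powR_sub1// spos.
Qed.

Lemma concave_case (n : nat) (kappa : R) (W : 'rV[R]_n -> R) (Omega : set 'rV[R]_n)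
    (g : 'rV[R]_n -> R) :
  0 < kappa -> (forall x, Omega x -> 0 < W x) -> open Omega -> bounded_set Omega ->
  convex_set_rV Omega -> concave_on Omega W ->
  C2_on Omega W -> (forall x, Omega x -> hessian W x \in unitmx) ->
  C1_on setT g -> compactly_supported_in Omega g ->
  iint (fun x => (g x * rho kappa W Omega x)%:E) = (0 : R)%:E ->
  (iint (fun x => (g x ^+ 2 * W x * rho kappa W Omega x)%:E)
   <= (- kappa)%:E *
      iint (fun x => (if `[< Omega x >] then
                        (grad (fun x => g x * W x) x *m invmx (hessian W x)
                         *m (grad (fun x => g x * W x) x)^T) 0 0
                        * rho kappa W Omega x
                      else 0)%:E))%E.
Proof.
move=> k0 W0 oO bO vO cW C2W uW C1g [K [cK KO gK]] intg.
have [U [DU [D2U [[cU cDU cD2U dU dDU sU] nsdU UK]]]] :=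
  concave_extension oO bO vO C2W cW cK KO.
(* With the junction below all values of U on [K], the exponential piece never acts on the support
   of g. *)
have [s0 s00 hs0] : exists2 s0, 0 < s0 & forall x, K x -> s0 <= U x.
  by apply: compact_lower_bound => // x Kx; rewrite (UK _ Kx).1 W0//; exact: KO.
have b0 : 0 < kappa^-1 by rewrite invr_gt0.
have [phi [r [dr [dphi drv cdr r0 [dr0 phi_le phi0 rE drE]]]]] := extended_power b0 s00.
apply: (@brascamp_lieb_of_extension R n Omega K W g kappa 1 oO cK KO C2W W0 uW C1g gK _ _
  phi r dr setT (fun=> 1) (fun _ _ => True) _ _ _ _ _ _ _ _ U DU D2U) => //.
- by rewrite mulr1.
- by rewrite mul1r.
- by move=> s _; exact: cdr.
- by move=> s _; rewrite mul1r.
(* With [a] constantly 1 the gap (m + s)^2 - 2 m s - m^2 is s^2, so no restriction on the dimension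
   arises. *)
- move=> _ m s u _ _; split => //; rewrite !mul1r ler_wpM2r//.
  by rewrite -subr_ge0 (_ : _ - _ = s ^+ 2) ?sqr_ge0//; ring.
- by move=> x Kx; rewrite scale1r (UK _ Kx).2.
- by move=> x Kx; rewrite rE ?hs0// (UK _ Kx).1.
- move=> x Kx; rewrite drE ?hs0// (UK _ Kx).1 mul1r mulrA divff ?mul1r// gt_eqF//.
Qed.

End PositiveExponent.

Theorem theorem5 (R : realType) (n : nat) (kappa : R)
    (W : 'rV[R]_n -> R) (Omega : set 'rV[R]_n) :
  (0 < n)%N ->
  (forall x, 0 <= W x) ->
  ((0 < kappa /\ Omega = [set x | 0 < W x] /\ open Omega /\
      bounded_set Omega /\ convex_set_rV Omega /\ concave_on Omega W)
   \/
   (- (n%:R)^-1 <= kappa /\ kappa < 0 /\ Omega = setT /\ convex_on setT W)) ->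
  iint (fun x => (rho kappa W Omega x)%:E) = 1%E ->
  C2_on Omega W ->
  (forall x, Omega x -> hessian W x \in unitmx) ->
  forall g : 'rV[R]_n -> R,
    C1_on setT g ->
    compactly_supported_in Omega g ->
    iint (fun x => (g x * rho kappa W Omega x)%:E) = (0 : R)%:E ->
    let f := fun x => g x * W x in
    (iint (fun x => (g x ^+ 2 * W x * rho kappa W Omega x)%:E)
     <= (- kappa)%:E *
        iint (fun x => (if `[< Omega x >] then
                          (grad f x *m invmx (hessian W x) *m (grad f x)^T) 0 0
                          * rho kappa W Omega x
                        else 0)%:E))%E.
Proof.
move=> n0 W0 [[k0 [OE [oO [bO [vO cW]]]]]|[kn [k0 [OE cW]]]] int1 C2W uW g C1g sg intg.
  apply: concave_case => //; by rewrite OE.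
subst Omega; apply: convex_case => // x; exact: uW.
Qed.
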